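(* Let $F:\mathcal{D}\to\mathcal{E}$ be an additive functor of exact categories, where both $\mathcal{D}$ and $\mathcal{E}$ are weakly $(\omega,\mathbf{AdMon})$-elementary and $\mathcal{D}$ has a homologically right complete, admissible left truncation system $(T_n,\psi_n)$. Suppose that $F$ commutes with countable coproducts. Let $\mathcal{B}$ be a subcategory of $Ch_+(\mathcal{D})$ which is a homological left deformation of $F$. Then $F:Ch(\mathcal{D})\to Ch(\mathcal{E})$ is left deformable.
   Context: Exact categories are Quillen exact categories, assumed weakly idempotent complete; $\mathbf{AdMon}$ denotes admissible monomorphisms. $Ch(\mathcal{D})$ (resp. $Ch_+(\mathcal{D})$) is the category of unbounded (resp. bounded below) complexes, homologically graded. A quasi-isomorphism (weak equivalence) is a chain map with acyclic cone. $F$ also denotes the induced functor on complexes. $\mathcal{E}$ is weakly $(\omega,\mathbf{AdMon})$-elementary if colimits of functors $\omega\to\mathcal{E}$ with all transition maps admissible monomorphisms exist, and the colimit functor on the category of such functors sends object-wise short exact sequences to short exact sequences. $F:Ch(\mathcal{D})\to Ch(\mathcal{E})$ is left deformable if there is a functor $Q:Ch(\mathcal{D})\to Ch(\mathcal{D})$ and a natural weak equivalence $\eta:Q\to\mathrm{Id}$ such that $F$ preserves weak equivalences between objects in the essential image of $Q$. A full subcategory $i_{\mathcal{B}}:\mathcal{B}\to Ch_+(\mathcal{D})$ is a homological left deformation of $Ch_+(\mathcal{D})$ if it is degree-wise split extension closed (if $0\to X\to Y\to Z\to0$ is split exact in each degree with $X,Z\in\mathcal{B}$, then $Y\in\mathcal{B}$)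 and there are a functor $Q_+:Ch_+(\mathcal{D})\to\mathcal{B}$ and a natural quasi-isomorphism $\eta:i_{\mathcal{B}}\circ Q_+\to\mathrm{Id}$ which is an admissible epimorphism in each degree, such that $Q_+(X)$ is concentrated in degrees $\ge n$ whenever $X$ is. It is a homological left deformation of $F$ if moreover $F$ preserves weak equivalences between complexes in $\mathcal{B}$. A left truncation system on $\mathcal{D}$ is a sequence of functors $T_0\to T_1\to\cdots$, $T_n:Ch(\mathcal{D})\to Ch(\mathcal{D})$, with natural transformations $\psi_n:T_n\to\mathrm{Id}$ compatible with $T_n\to T_{n+1}$, such that: for all $X$ and $n\in\mathbb{N}$, $T_n(X)$ is concentrated in degrees $\ge -n$; the map $T_nT_{n+1}\to T_n$ is a natural quasi-isomorphism; $T_n(X)\to X$ is an admissible epimorphism in degrees $>-n$; if $X$ is concentrated in degrees $\ge-n$, then $T_n(X)\to X$ is a quasi-isomorphism; $T_n$ preserves weak equivalences. It is admissible if the maps $T_n(X)\to T_{n+1}(X)$ are admissible monomorphisms in degrees $>-n$, and homologically right complete if $\mathrm{colim}_\omega\psi_n$ exists and is a natural weak equivalence. *)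

(* Defs.v *)
From mathcomp Require Import all_boot all_order all_algebra.
From mathcomp Require Import boolp.

Set Implicit Arguments.
Unset Strict Implicit.
Unset Printing Implicit Defensive.

Import Order.TTheory GRing.Theory Num.Theory.
Local Open Scope ring_scope.

Declare Scope cat_scope.
Delimit Scope cat_scope with cat.

Record category := Category {
  obj :> Type;
  hom : obj -> obj -> Type;
  idm : forall X, hom X X;
  comp : forall X Y Z, hom Y Z -> hom X Y -> hom X Z;
  comp_idl : forall X Y (f : hom X Y), comp (idm Y) f = f;
  comp_idr : forall X Y (f : hom X Y), comp f (idm X) = f;
  comp_assoc : forall X Y Z W (h : hom Z W) (g : hom Y Z) (f : hom X Y),
    comp h (comp g f) = comp (comp h g) f }.

Arguments hom {c} _ _.
Arguments idm {c} X.
Arguments comp {c X Y Z} _ _.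

Notation "g ∘ f" := (comp g f) (at level 40, left associativity) : cat_scope.
Local Open Scope cat_scope.

Definition is_iso (C : category) (X Y : C) (f : hom X Y) : Prop :=
  exists g : hom Y X, g ∘ f = idm X /\ f ∘ g = idm Y.

Definition is_zero (C : category) (Z : C) : Prop :=
  (forall X : C, exists! f : hom Z X, True) /\
  (forall X : C, exists! f : hom X Z, True).

Definition is_coproduct (C : category) (I : Type) (X : I -> C) (P : C)
    (inj : forall i, hom (X i) P) : Prop :=
  forall (W : C) (u : forall i, hom (X i) W),
    exists! w : hom P W, forall i, w ∘ inj i = u i.

Definition is_pushout (C : category) (A B A' B' : C) (i : hom A B)
    (f : hom A A') (i' : hom A' B') (f' : hom B B') : Prop :=
  i' ∘ f = f' ∘ i /\
  forall (W : C) (u : hom A' W) (v : hom B W), u ∘ f = v ∘ i ->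
    exists! w : hom B' W, w ∘ i' = u /\ w ∘ f' = v.

Definition is_pullback (C : category) (B' A' B A : C) (p' : hom B' A')
    (f' : hom B' B) (f : hom A' A) (p : hom B A) : Prop :=
  f ∘ p' = p ∘ f' /\
  forall (W : C) (u : hom W A') (v : hom W B), f ∘ u = p ∘ v ->
    exists! w : hom W B', p' ∘ w = u /\ f' ∘ w = v.

(* A functor from the poset [omega] is given by its values on the objects [n]
   and on the generating arrows [n -> n.+1]; its other transition maps are the
   finite composites of these. *)
Record omega_diagram (C : category) := OmegaDiagram {
  dobj :> nat -> C;
  dmap : forall n, hom (dobj n) (dobj n.+1) }.

Definition is_cocone (C : category) (X : omega_diagram C) (L : C)
    (c : forall n, hom (X n) L) : Prop :=
  forall n, c n.+1 ∘ dmap X n = c n.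

Definition is_colimit (C : category) (X : omega_diagram C) (L : C)
    (c : forall n, hom (X n) L) : Prop :=
  is_cocone c /\
  forall (W : C) (u : forall n, hom (X n) W), is_cocone u ->
    exists! w : hom L W, forall n, w ∘ c n = u n.

Record functor (C D : category) := Functor {
  fobj :> C -> D;
  fmap : forall X Y, hom X Y -> hom (fobj X) (fobj Y);
  fmap_id : forall X, fmap (idm X) = idm (fobj X);
  fmap_comp : forall X Y Z (g : hom Y Z) (f : hom X Y),
    fmap (g ∘ f) = fmap g ∘ fmap f }.

Arguments fmap {C D} _ {X Y} _.

Definition id_functor (C : category) : functor C C :=
  @Functor C C (fun X => X) (fun X Y f => f)
    (fun X => erefl) (fun X Y Z g f => erefl).

Lemma comp_functor_id (C D E : category) (G : functor D E) (F : functor C D)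
    (X : C) : fmap G (fmap F (idm X)) = idm (G (F X)).
Proof. by rewrite !fmap_id. Qed.

Lemma comp_functor_comp (C D E : category) (G : functor D E) (F : functor C D)
    (X Y Z : C) (g : hom Y Z) (f : hom X Y) :
  fmap G (fmap F (g ∘ f)) = fmap G (fmap F g) ∘ fmap G (fmap F f).
Proof. by rewrite !fmap_comp. Qed.

Definition comp_functor (C D E : category) (G : functor D E)
    (F : functor C D) : functor C E :=
  @Functor C E (fun X => G (F X)) (fun X Y f => fmap G (fmap F f))
    (comp_functor_id G F) (comp_functor_comp G F).

Record nat_trans (C D : category) (F G : functor C D) := NatTrans {
  component :> forall X, hom (F X) (G X);
  naturality : forall X Y (f : hom X Y),
    component Y ∘ fmap F f = fmap G f ∘ component X }.

Definition essential_image (C D : category) (F : functor C D) (Y : D) : Prop :=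
  exists (X : C) (f : hom (F X) Y), is_iso f.

Section FullSubcategory.
Variables (C : category) (P : C -> Prop).

Definition full_sub : category :=
  @Category {X : C | P X} (fun X Y => hom (proj1_sig X) (proj1_sig Y))
    (fun X => idm (proj1_sig X)) (fun X Y Z g f => g ∘ f)
    (fun X Y f => comp_idl f) (fun X Y f => comp_idr f)
    (fun X Y Z W h g f => comp_assoc h g f).

Definition full_incl : functor full_sub C :=
  @Functor full_sub C (fun X => proj1_sig X) (fun X Y f => f)
    (fun X => erefl) (fun X Y Z g f => erefl).

End FullSubcategory.

(* Asking for a [zmodType] (rather than a bare abelian group) costs nothing
   classically, since every type then carries a [choiceType] structure. *)
Record preadditive := Preadditive {
  pobj : Type;
  phom : pobj -> pobj -> zmodType;
  pid : forall X, phom X X;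
  pcomp : forall X Y Z, phom Y Z -> phom X Y -> phom X Z;
  pcomp_idl : forall X Y (f : phom X Y), pcomp (pid Y) f = f;
  pcomp_idr : forall X Y (f : phom X Y), pcomp f (pid X) = f;
  pcomp_assoc : forall X Y Z W (h : phom Z W) (g : phom Y Z) (f : phom X Y),
    pcomp h (pcomp g f) = pcomp (pcomp h g) f;
  pcompDl : forall X Y Z (g g' : phom Y Z) (f : phom X Y),
    pcomp (g + g') f = pcomp g f + pcomp g' f;
  pcompDr : forall X Y Z (g : phom Y Z) (f f' : phom X Y),
    pcomp g (f + f') = pcomp g f + pcomp g f' }.

Coercion category_of_preadditive (A : preadditive) : category :=
  @Category (pobj A) (fun X Y => phom X Y) (@pid A) (@pcomp A)
    (@pcomp_idl A) (@pcomp_idr A) (@pcomp_assoc A).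

Section PreadditiveTheory.
Variable A : preadditive.
Implicit Types X Y Z : A.

Lemma compDl X Y Z (g g' : hom Y Z) (f : hom X Y) :
  (g + g' : hom Y Z) ∘ f = g ∘ f + g' ∘ f.
Proof. exact: pcompDl. Qed.

Lemma compDr X Y Z (g : hom Y Z) (f f' : hom X Y) :
  g ∘ (f + f' : hom X Y) = g ∘ f + g ∘ f'.
Proof. exact: pcompDr. Qed.

Lemma comp0l X Y Z (f : hom X Y) : (0 : hom Y Z) ∘ f = 0.
Proof. by apply: (addrI ((0 : hom Y Z) ∘ f)); rewrite -compDl !addr0. Qed.

Lemma comp0r X Y Z (g : hom Y Z) : g ∘ (0 : hom X Y) = 0.
Proof. by apply: (addrI (g ∘ (0 : hom X Y))); rewrite -compDr !addr0. Qed.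

Lemma compNl X Y Z (g : hom Y Z) (f : hom X Y) : (- g : hom Y Z) ∘ f = - (g ∘ f).
Proof. by apply: (addrI (g ∘ f)); rewrite -compDl !subrr comp0l. Qed.

Lemma compNr X Y Z (g : hom Y Z) (f : hom X Y) : g ∘ (- f : hom X Y) = - (g ∘ f).
Proof. by apply: (addrI (g ∘ f)); rewrite -compDr !subrr comp0r. Qed.

End PreadditiveTheory.

Record biproduct (A : preadditive) (X Y : A) := Biproduct {
  bobj :> A;
  binl : hom X bobj;
  binr : hom Y bobj;
  prl : hom bobj X;
  prr : hom bobj Y;
  prl_binl : prl ∘ binl = idm X;
  prr_binr : prr ∘ binr = idm Y;
  prl_binr : prl ∘ binr = 0;
  prr_binl : prr ∘ binl = 0;
  biproduct_id : binl ∘ prl + binr ∘ prr = idm bobj }.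

Arguments binl {A X Y} b.
Arguments binr {A X Y} b.
Arguments prl {A X Y} b.
Arguments prr {A X Y} b.

Record additive_category := AdditiveCategory {
  additive_preadditive :> preadditive;
  zero_object : additive_preadditive;
  zero_objectP : is_zero zero_object;
  biprod : forall X Y : additive_preadditive, biproduct X Y }.

Arguments biprod {a} X Y.

Record additive_functor (A B : preadditive) := AdditiveFunctor {
  additive_fun :> functor A B;
  fmapD : forall (X Y : A) (f g : hom X Y),
    fmap additive_fun (f + g) =
    fmap additive_fun f + fmap additive_fun g }.

Definition preserves_countable_coproducts (C D : category) (F : functor C D) :=
  forall (I : countType) (X : I -> C) (P : C) (inj : forall i, hom (X i) P),
    is_coproduct inj -> is_coproduct (fun i => fmap F (inj i)).

Definition is_kernel (A : preadditive) (K X Y : A) (f : hom X Y)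
    (k : hom K X) : Prop :=
  f ∘ k = 0 /\
  forall (W : A) (u : hom W X), f ∘ u = 0 ->
    exists! v : hom W K, k ∘ v = u.

Definition is_cokernel (A : preadditive) (X Y Q : A) (f : hom X Y)
    (q : hom Y Q) : Prop :=
  q ∘ f = 0 /\
  forall (W : A) (u : hom Y W), u ∘ f = 0 ->
    exists! v : hom Q W, v ∘ q = u.

Definition split_exact (A : preadditive) (X Y Z : A) (f : hom X Y)
    (g : hom Y Z) : Prop :=
  g ∘ f = 0 /\
  exists (r : hom Y X) (s : hom Z Y),
    [/\ r ∘ f = idm X, g ∘ s = idm Z & f ∘ r + s ∘ g = idm Y].

Definition weakly_idempotent_complete (A : preadditive) : Prop :=
  forall (X Y : A) (r : hom X Y), (exists s : hom Y X, r ∘ s = idm Y) ->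
    exists (K : A) (k : hom K X), is_kernel r k.

Section AdmissibleMaps.
Variables (A : preadditive).
Variable ses : forall X Y Z : A, hom X Y -> hom Y Z -> Prop.

Definition adm_mono_for (X Y : A) (i : hom X Y) : Prop :=
  exists (Z : A) (p : hom Y Z), ses i p.
Definition adm_epi_for (Y Z : A) (p : hom Y Z) : Prop :=
  exists (X : A) (i : hom X Y), ses i p.

End AdmissibleMaps.

(* The axioms are [E0], [E1], [E2] and their duals, in Bühler's form of
   Quillen's definition. *)
Record exact_category := ExactCategory {
  exact_additive :> additive_category;
  ses : forall X Y Z : exact_additive, hom X Y -> hom Y Z -> Prop;
  ses_kernel : forall (X Y Z : exact_additive) (i : hom X Y) (p : hom Y Z),
    ses i p -> is_kernel p i;
  ses_cokernel : forall (X Y Z : exact_additive) (i : hom X Y) (p : hom Y Z),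
    ses i p -> is_cokernel i p;
  ses_iso : forall (X Y Z X' Y' Z' : exact_additive)
    (i : hom X Y) (p : hom Y Z) (i' : hom X' Y') (p' : hom Y' Z')
    (a : hom X X') (b : hom Y Y') (c : hom Z Z'),
    is_iso a -> is_iso b -> is_iso c ->
    b ∘ i = i' ∘ a -> c ∘ p = p' ∘ b -> ses i p -> ses i' p';
  adm_mono_id : forall X : exact_additive, adm_mono_for ses (idm X);
  adm_epi_id : forall X : exact_additive, adm_epi_for ses (idm X);
  adm_mono_comp : forall (X Y Z : exact_additive) (j : hom Y Z) (i : hom X Y),
    adm_mono_for ses j -> adm_mono_for ses i -> adm_mono_for ses (j ∘ i);
  adm_epi_comp : forall (X Y Z : exact_additive) (q : hom Y Z) (p : hom X Y),
    adm_epi_for ses q -> adm_epi_for ses p -> adm_epi_for ses (q ∘ p);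
  adm_mono_pushout : forall (X Y X' : exact_additive) (i : hom X Y)
    (f : hom X X'), adm_mono_for ses i ->
    exists (Y' : exact_additive) (i' : hom X' Y') (f' : hom Y Y'),
      is_pushout i f i' f' /\ adm_mono_for ses i';
  adm_epi_pullback : forall (Y Z Z' : exact_additive) (p : hom Y Z)
    (f : hom Z' Z), adm_epi_for ses p ->
    exists (Y' : exact_additive) (p' : hom Y' Z') (f' : hom Y' Y),
      is_pullback p' f' f p /\ adm_epi_for ses p' }.

Arguments ses {e X Y Z} _ _.

Definition adm_mono (E : exact_category) (X Y : E) (i : hom X Y) : Prop :=
  adm_mono_for (@ses E) i.
Definition adm_epi (E : exact_category) (Y Z : E) (p : hom Y Z) : Prop :=
  adm_epi_for (@ses E) p.

(* In the second clause, [u] and [v] are the maps induced on colimits. *)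
Definition weakly_omega_AdMon_elementary (E : exact_category) : Prop :=
  (forall X : omega_diagram E, (forall n, adm_mono (dmap X n)) ->
    exists (L : E) (c : forall n, hom (X n) L), is_colimit c) /\
  (forall (X Y Z : omega_diagram E)
      (f : forall n, hom (X n) (Y n)) (g : forall n, hom (Y n) (Z n))
      (LX LY LZ : E) (cX : forall n, hom (X n) LX)
      (cY : forall n, hom (Y n) LY) (cZ : forall n, hom (Z n) LZ)
      (u : hom LX LY) (v : hom LY LZ),
    (forall n, adm_mono (dmap X n)) -> (forall n, adm_mono (dmap Y n)) ->
    (forall n, adm_mono (dmap Z n)) ->
    (forall n, f n.+1 ∘ dmap X n = dmap Y n ∘ f n) ->
    (forall n, g n.+1 ∘ dmap Y n = dmap Z n ∘ g n) ->
    (forall n, ses (f n) (g n)) ->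
    is_colimit cX -> is_colimit cY -> is_colimit cZ ->
    (forall n, u ∘ cX n = cY n ∘ f n) ->
    (forall n, v ∘ cY n = cZ n ∘ g n) ->
    ses u v).

Record complex (A : preadditive) := Complex {
  deg :> int -> A;
  diff : forall n : int, hom (deg n) (deg (n - 1));
  diff_diff : forall n : int, diff (n - 1) ∘ diff n = 0 }.

Record chain_map (A : preadditive) (X Y : complex A) := ChainMap {
  at_deg :> forall n : int, hom (X n) (Y n);
  chain_mapP : forall n : int,
    at_deg (n - 1) ∘ diff X n = diff Y n ∘ at_deg n }.

Section ComplexCategory.
Variable A : preadditive.
Implicit Types X Y Z : complex A.

Lemma chain_map_ext X Y (f g : chain_map X Y) :
  (forall n, f n = g n) -> f = g.
Proof.
case: f g => [f fP] [g gP] /= fg.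
have e : f = g by apply: functional_extensionality_dep.
by case: _ / e gP => gP; congr ChainMap; apply: Prop_irrelevance.
Qed.

Lemma chain_map_idP X (n : int) :
  idm (X (n - 1)) ∘ diff X n = diff X n ∘ idm (X n).
Proof. by rewrite comp_idl comp_idr. Qed.

Definition chain_map_id X : chain_map X X := ChainMap (chain_map_idP X).

Lemma chain_map_compP X Y Z (g : chain_map Y Z) (f : chain_map X Y) (n : int) :
  (g (n - 1) ∘ f (n - 1)) ∘ diff X n = diff Z n ∘ (g n ∘ f n).
Proof.
by rewrite -comp_assoc chain_mapP comp_assoc chain_mapP comp_assoc.
Qed.

Definition chain_map_comp X Y Z (g : chain_map Y Z) (f : chain_map X Y) :
  chain_map X Z := ChainMap (chain_map_compP g f).

Lemma chain_map_comp_idl X Y (f : chain_map X Y) :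
  chain_map_comp (chain_map_id Y) f = f.
Proof. by apply: chain_map_ext => n; apply: comp_idl. Qed.

Lemma chain_map_comp_idr X Y (f : chain_map X Y) :
  chain_map_comp f (chain_map_id X) = f.
Proof. by apply: chain_map_ext => n; apply: comp_idr. Qed.

Lemma chain_map_comp_assoc X Y Z W (h : chain_map Z W) (g : chain_map Y Z)
    (f : chain_map X Y) :
  chain_map_comp h (chain_map_comp g f) =
  chain_map_comp (chain_map_comp h g) f.
Proof. by apply: chain_map_ext => n; apply: comp_assoc. Qed.

Definition Ch : category :=
  @Category (complex A) (@chain_map A) chain_map_id chain_map_comp
    chain_map_comp_idl chain_map_comp_idr chain_map_comp_assoc.

Definition concentrated_ge (n : int) X : Prop :=
  forall k : int, k < n -> is_zero (X k).

Definition bounded_below X : Prop := exists n : int, concentrated_ge n X.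

End ComplexCategory.

Definition Chplus (A : preadditive) : category :=
  full_sub (C := Ch A) (@bounded_below A).

Section InducedFunctor.
Variables (A B : preadditive) (F : additive_functor A B).

Lemma additive_functor0 (X Y : A) : fmap F (0 : hom X Y) = 0.
Proof.
by apply: (addrI (fmap F (0 : hom X Y))); rewrite -fmapD !addr0.
Qed.

Lemma Ch_fobjP (X : complex A) (n : int) :
  fmap F (diff X (n - 1)) ∘ fmap F (diff X n) = 0.
Proof. by rewrite -(fmap_comp F) diff_diff additive_functor0. Qed.

Definition Ch_fobj (X : complex A) : complex B :=
  @Complex B (fun n => F (X n)) (fun n => fmap F (diff X n)) (Ch_fobjP X).

Lemma Ch_fmapP (X Y : complex A) (f : chain_map X Y) (n : int) :
  fmap F (f (n - 1)) ∘ diff (Ch_fobj X) n =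
  diff (Ch_fobj Y) n ∘ fmap F (f n).
Proof.
have := congr1 (fmap F) (chain_mapP f n).
by rewrite (fmap_comp F) => ->; apply: fmap_comp.
Qed.

Definition Ch_fmap (X Y : complex A) (f : chain_map X Y) :
  chain_map (Ch_fobj X) (Ch_fobj Y) :=
  @ChainMap B (Ch_fobj X) (Ch_fobj Y) (fun n => fmap F (f n)) (Ch_fmapP f).

Lemma Ch_fmap_id (X : Ch A) : Ch_fmap (idm X) = @idm (Ch B) (Ch_fobj X).
Proof. by apply: chain_map_ext => n; apply: fmap_id. Qed.

Lemma Ch_fmap_comp (X Y Z : Ch A) (g : hom Y Z) (f : hom X Y) :
  Ch_fmap (g ∘ f) = @comp (Ch B) _ _ _ (Ch_fmap g) (Ch_fmap f).
Proof. by apply: chain_map_ext => n; apply: fmap_comp. Qed.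

Definition Ch_functor : functor (Ch A) (Ch B) :=
  @Functor (Ch A) (Ch B) Ch_fobj Ch_fmap Ch_fmap_id Ch_fmap_comp.

End InducedFunctor.

Section Cone.
Variables (A : additive_category) (X Y : complex A) (f : chain_map X Y).

Definition cone_obj (n : int) : A := biprod (X (n - 1)) (Y n).

(* The matrix [[- d_X, 0], [f, d_Y]]. *)
Definition cone_diff (n : int) : hom (cone_obj n) (cone_obj (n - 1)) :=
  binl _ ∘ (- diff X (n - 1)) ∘ prl _ +
  binr _ ∘ (f (n - 1) ∘ prl _ + diff Y n ∘ prr _).

Lemma prl_cone_diff (n : int) :
  prl _ ∘ cone_diff n = - (diff X (n - 1) ∘ prl _).
Proof.
rewrite /cone_diff /cone_obj compDr !comp_assoc prl_binl prl_binr comp_idl !comp0l addr0.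
exact: compNl.
Qed.

Lemma prr_cone_diff (n : int) :
  prr _ ∘ cone_diff n = f (n - 1) ∘ prl _ + diff Y n ∘ prr _.
Proof.
rewrite /cone_diff /cone_obj compDr !comp_assoc prr_binl prr_binr comp_idl !comp0l add0r.
by [].
Qed.

Lemma cone_diff_diff (n : int) : cone_diff (n - 1) ∘ cone_diff n = 0.
Proof.
rewrite {1}/cone_diff compDl -!comp_assoc compDl -!comp_assoc.
rewrite prl_cone_diff prr_cone_diff.
rewrite compNl !compNr opprK (comp_assoc (diff X _)) (diff_diff X (n - 1)).
rewrite comp0l comp0r add0r (compDr (diff Y (n - 1))).
rewrite !(comp_assoc (diff Y (n - 1))) (comp_assoc (f _)) (diff_diff Y n).
by rewrite (chain_mapP f (n - 1)) comp0l addr0 addNr comp0r.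
Qed.

Definition cone : complex A := Complex cone_diff_diff.

End Cone.

Section WeakEquivalences.
Variable E : exact_category.

Definition acyclic (X : complex E) : Prop :=
  exists (Z : int -> E) (i : forall n : int, hom (Z n) (X n))
         (p : forall n : int, hom (X n) (Z (n - 1))),
    forall n : int,
      diff X n = i (n - 1) ∘ p n /\ ses (i n) (p n).

Definition quasi_iso (X Y : complex E) (f : chain_map X Y) : Prop :=
  acyclic (cone f).

End WeakEquivalences.

Section Deformations.
Variables D E : exact_category.

Definition left_deformable (F : functor (Ch D) (Ch E)) : Prop :=
  exists (Q : functor (Ch D) (Ch D)) (eta : nat_trans Q (id_functor (Ch D))),
    (forall X : Ch D, quasi_iso (eta X)) /\
    (forall (X Y : Ch D) (f : hom X Y),
      essential_image Q X -> essential_image Q Y ->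
      quasi_iso f -> quasi_iso (fmap F f)).

Definition degreewise_split_extension_closed (B : Chplus D -> Prop) : Prop :=
  forall (X Y Z : Chplus D) (f : hom X Y) (g : hom Y Z),
    (forall n : int, split_exact (at_deg f n) (at_deg g n)) ->
    B X -> B Z -> B Y.

Definition homological_left_deformation (B : Chplus D -> Prop) : Prop :=
  degreewise_split_extension_closed B /\
  exists (Qplus : functor (Chplus D) (full_sub B))
         (eta : nat_trans (comp_functor (full_incl B) Qplus)
                          (id_functor (Chplus D))),
    [/\ forall X : Chplus D, quasi_iso (eta X),
        forall (X : Chplus D) (n : int), adm_epi (at_deg (eta X) n)
      & forall (X : Chplus D) (n : int),
          concentrated_ge n (full_incl _ X) ->
          concentrated_ge n (full_incl _ (full_incl B (Qplus X)))].

Definition homological_left_deformation_of (F : functor (Ch D) (Ch E))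
    (B : Chplus D -> Prop) : Prop :=
  homological_left_deformation B /\
  forall (X Y : Chplus D) (f : hom X Y), B X -> B Y ->
    quasi_iso f -> quasi_iso (fmap F (fmap (full_incl _) f)).

End Deformations.

Section TruncationSystems.
Variable D : exact_category.

Record left_truncation_system := LeftTruncationSystem {
  trunc : nat -> functor (Ch D) (Ch D);
  trunc_map : forall n, nat_trans (trunc n) (trunc n.+1);
  trunc_psi : forall n, nat_trans (trunc n) (id_functor (Ch D));
  trunc_compat : forall (n : nat) (X : Ch D),
    trunc_psi n.+1 X ∘ trunc_map n X = trunc_psi n X;
  trunc_conc : forall (n : nat) (X : Ch D),
    concentrated_ge (- n%:Z) (trunc n X);
  trunc_trunc : forall (n : nat) (X : Ch D),
    quasi_iso (fmap (trunc n) (trunc_psi n.+1 X));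
  trunc_epi : forall (n : nat) (X : Ch D) (k : int),
    - n%:Z < k -> adm_epi (at_deg (trunc_psi n X) k);
  trunc_quasi_iso : forall (n : nat) (X : Ch D),
    concentrated_ge (- n%:Z) X -> quasi_iso (trunc_psi n X);
  trunc_preserves : forall (n : nat) (X Y : Ch D) (f : hom X Y),
    quasi_iso f -> quasi_iso (fmap (trunc n) f) }.

Definition trunc_diagram (T : left_truncation_system) (X : Ch D) :
  omega_diagram (Ch D) :=
  @OmegaDiagram (Ch D) (fun n => trunc T n X) (fun n => trunc_map T n X).

Definition admissible_truncation (T : left_truncation_system) : Prop :=
  forall (n : nat) (X : Ch D) (k : int), - n%:Z < k ->
    adm_mono (at_deg (trunc_map T n X) k).

(* [u] is the map [colim_n T_n X -> X] induced by the [psi_n]. *)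
Definition homologically_right_complete (T : left_truncation_system) : Prop :=
  forall X : Ch D,
    exists (L : Ch D) (c : forall n, hom (trunc_diagram T X n) L) (u : hom L X),
      [/\ is_colimit c, forall n, u ∘ c n = trunc_psi T n X & quasi_iso u].

End TruncationSystems.

(* Main.v *)
(** The resolution of a complex [X] is the colimit of resolutions [V_n] of its
    truncations [T_n X].  They are built one from the other inside [B]: resolving
    the cone [C] of [V_n -> T_n X -> T_(n+1) X] by [P -> C] and adding [P] to [V_n]
    along [P -> C -> V_n[1]] gives a degreewise split extension [V_(n+1)] of [P] by
    [V_n], and the cone of [V_(n+1) -> T_(n+1) X] is isomorphic to that of [P -> C].
    In each degree the colimit [Q X] is a countable coproduct, so that [F] preserves
    it, and colimits along admissible monomorphisms preserve acyclicity.

    A quasi-isomorphism between objects of the image of [Q] need not come from the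
    tower, so one also needs [F (Q Y) -> F Y] to be a quasi-isomorphism for
    [Y = Q X].  With [Y_m = V_m X], the map [V_a Y_b -> Y_b] is a quasi-isomorphism
    for [b <= a], and [V_a Y_b -> V_a Y] is one for [b = a + 1], because
    [T_a T_(a+1) -> T_a] is.  Resolving the interleaved sequence [V_0 Y_0], [V_0 Y_1],
    [V_1 Y_1], [V_1 Y_2], ... gives a complex mapping to both [Y] and [Q Y], and both
    maps become quasi-isomorphisms under [F], by the even and the odd terms.

    Acyclicity of unbounded complexes is invariant under homotopy only if idempotents
    split; here they do, by a swindle in a countable power.  Two-out-of-three for
    quasi-isomorphisms then follows by exhibiting one cone (or its shift) as a retract
    of a cone of a map between the other two. *)

From mathcomp Require Import all_boot all_order all_algebra.
From mathcomp Require Import boolp.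
Require Import Defs.

Set Implicit Arguments.
Unset Strict Implicit.
Unset Printing Implicit Defensive.

Import Order.TTheory GRing.Theory Num.Theory.
Local Open Scope ring_scope.
Local Open Scope cat_scope.

Local Arguments comp : simpl never.
Local Arguments hom : simpl never.
Local Arguments idm : simpl never.

(** * Exact categories *)

Lemma dep_choice (I : Type) (T : I -> Type) (R : forall i, T i -> Prop) :
  (forall i, exists x, R i x) -> exists f : forall i, T i, forall i, R i (f i).
Proof. by move=> h; exists (fun i => projT1 (cid (h i))) => i; case: cid. Qed.

Definition monic (C : category) (X Y : C) (f : hom X Y) : Prop :=
  forall (W : C) (u v : hom W X), f ∘ u = f ∘ v -> u = v.

Lemma is_iso_id (C : category) (X : C) : is_iso (idm X).
Proof. by exists (idm X); rewrite !comp_idl. Qed.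

Lemma is_iso_inv (C : category) (X Y : C) (f : hom X Y) :
  is_iso f -> exists2 g : hom Y X, is_iso g & g ∘ f = idm X /\ f ∘ g = idm Y.
Proof. by case=> g [gf fg]; exists g => //; exists f. Qed.

(** * Opposite exact categories, which give the dual of each statement for free *)

Section Opposite.

Definition op_preadditive (A : preadditive) : preadditive :=
  @Preadditive (pobj A) (fun X Y => phom Y X) (@pid A)
    (fun X Y Z g f => pcomp f g) (fun X Y f => pcomp_idr f)
    (fun X Y f => pcomp_idl f)
    (fun X Y Z W h g f => esym (pcomp_assoc f g h))
    (fun X Y Z g g' f => pcompDr f g g') (fun X Y Z g f f' => pcompDl f f' g).

Lemma op_zero_objectP (A : additive_category) :
  is_zero (C := op_preadditive A) (zero_object A).
Proof. by case: (zero_objectP A). Qed.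

Lemma biproduct_op_id (A : preadditive) (X Y : A) (b : biproduct X Y) :
  (prl b : @hom (op_preadditive A) _ _) ∘ binl b +
  (prr b : @hom (op_preadditive A) _ _) ∘ binr b = @idm (op_preadditive A) b.
Proof. exact: biproduct_id. Qed.

Definition op_biproduct (A : preadditive) (X Y : A) (b : biproduct X Y) :
  @biproduct (op_preadditive A) X Y :=
  @Biproduct (op_preadditive A) X Y b (prl b) (prr b) (binl b) (binr b)
    (prl_binl b) (prr_binr b) (prr_binl b) (prl_binr b) (biproduct_op_id b).

Definition op_additive (A : additive_category) : additive_category :=
  @AdditiveCategory (op_preadditive A) (zero_object A) (op_zero_objectP A)
    (fun X Y => op_biproduct (biprod X Y)).

Lemma op_is_iso (A : preadditive) (X Y : A) (f : hom X Y) :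
  @is_iso (op_preadditive A) Y X f -> is_iso f.
Proof. by case=> g [gf fg]; exists g. Qed.

(** Passing to the opposite category reverses the three comparison isomorphisms, so closure under
    isomorphism in [E] is applied to their inverses. The other axioms come in dual pairs and are
    simply exchanged in [op_exact]. *)
Lemma op_ses_iso (E : exact_category) (X Y Z X' Y' Z' : op_additive E)
    (i : hom X Y) (p : hom Y Z) (i' : hom X' Y') (p' : hom Y' Z')
    (a : hom X X') (b : hom Y Y') (c : hom Z Z') :
  is_iso a -> is_iso b -> is_iso c ->
  b ∘ i = i' ∘ a -> c ∘ p = p' ∘ b ->
  @ses E Z Y X p i -> @ses E Z' Y' X' p' i'.
Proof.
move=> /is_iso_inv[a' ia [a1 a2]] /is_iso_inv[b' ib [b1 b2]].
move=> /is_iso_inv[c' ic [c1 c2]] ha hc.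
apply: (@ses_iso E _ _ _ _ _ _ p i p' i' c' b' a');
  [exact: op_is_iso ic|exact: op_is_iso ib|exact: op_is_iso ia| |].
- have : @comp (op_additive E) _ _ _ p b' = c' ∘ p'.
    by rewrite -[p']comp_idr -b2 -(comp_idl p) -c1 !comp_assoc -(comp_assoc c') hc
      comp_assoc.
  by [].
- have : @comp (op_additive E) _ _ _ i a' = b' ∘ i'.
    by rewrite -[i']comp_idr -a2 -(comp_idl i) -b1 !comp_assoc -(comp_assoc b') ha
      comp_assoc.
  by [].
Qed.

Definition op_exact (E : exact_category) : exact_category :=
  @ExactCategory (op_additive E) (fun X Y Z i p => @ses E Z Y X p i)
    (fun X Y Z i p h => ses_cokernel h) (fun X Y Z i p h => ses_kernel h)
    (@op_ses_iso E) (@adm_epi_id E) (@adm_mono_id E)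
    (fun X Y Z j i hj hi => adm_epi_comp hi hj)
    (fun X Y Z j i hj hi => adm_mono_comp hi hj)
    (fun X Y X' i f h => adm_epi_pullback f h)
    (fun X Y X' i f h => adm_mono_pushout f h).

End Opposite.

Section Preadditive.
Variable A : preadditive.
Implicit Types X Y Z W : A.

Lemma monic0 X Y (f : hom X Y) :
  (forall W (u : hom W X), f ∘ u = 0 -> u = 0) -> monic f.
Proof.
move=> h W u v e; apply/subr0_eq/h.
by rewrite (compDr f) (compNr f) e subrr.
Qed.

Lemma kernel_monic K X Y (f : hom X Y) (k : hom K X) :
  is_kernel f k -> monic k.
Proof.
case=> fk h W u v e.
have [|w [_ hw]] := h W (k ∘ u); first by rewrite comp_assoc fk comp0l.
by rewrite -(hw u erefl) -(hw v (esym e)).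
Qed.

Lemma kernel_lift K X Y W (f : hom X Y) (k : hom K X) (u : hom W X) :
  is_kernel f k -> f ∘ u = 0 -> exists v : hom W K, k ∘ v = u.
Proof. by case=> _ h /h [v [hv _]]; exists v. Qed.

Lemma is_kernelP K X Y (f : hom X Y) (k : hom K X) :
  f ∘ k = 0 -> monic k ->
  (forall W (u : hom W X), f ∘ u = 0 -> exists v : hom W K, k ∘ v = u) ->
  is_kernel f k.
Proof.
move=> fk mk h; split=> // W u /h [v hv]; exists v; split=> // v' hv'.
by apply: mk; rewrite hv.
Qed.

Lemma kernel_unique K K' X Y (f : hom X Y) (k : hom K X) (k' : hom K' X) :
  is_kernel f k -> is_kernel f k' ->
  exists2 a : hom K K', is_iso a & k' ∘ a = k.
Proof.
move=> hk hk'.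
have [a ha] := kernel_lift hk' hk.1; have [b hb] := kernel_lift hk hk'.1.
exists a => //; exists b; split.
  by apply: (kernel_monic hk); rewrite comp_assoc hb ha comp_idr.
by apply: (kernel_monic hk'); rewrite comp_assoc ha hb comp_idr.
Qed.

Lemma kernel_monic_comp K X Y Z (f : hom X Y) (g : hom Y Z) (k : hom K X) :
  monic g -> is_kernel f k -> is_kernel (g ∘ f) k.
Proof.
move=> mg [fk hk]; split; first by rewrite -comp_assoc fk comp0r.
move=> W u hu; apply: hk; apply: mg; by rewrite comp_assoc hu comp0r.
Qed.

Lemma prlK X Y W (b : biproduct X Y) (u : hom W X) : prl b ∘ (binl b ∘ u) = u.
Proof. by rewrite comp_assoc prl_binl comp_idl. Qed.

Lemma prrK X Y W (b : biproduct X Y) (u : hom W Y) : prr b ∘ (binr b ∘ u) = u.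
Proof. by rewrite comp_assoc prr_binr comp_idl. Qed.

Lemma prl_binr0 X Y W (b : biproduct X Y) (u : hom W Y) :
  prl b ∘ (binr b ∘ u) = 0.
Proof. by rewrite comp_assoc prl_binr comp0l. Qed.

Lemma prr_binl0 X Y W (b : biproduct X Y) (u : hom W X) :
  prr b ∘ (binl b ∘ u) = 0.
Proof. by rewrite comp_assoc prr_binl comp0l. Qed.

Lemma biproduct_decomp X Y W (b : biproduct X Y) (u : hom W b) :
  u = binl b ∘ (prl b ∘ u) + binr b ∘ (prr b ∘ u).
Proof. by rewrite !comp_assoc -compDl biproduct_id comp_idl. Qed.

Lemma biproduct_ext X Y W (b : biproduct X Y) (u v : hom W b) :
  prl b ∘ u = prl b ∘ v -> prr b ∘ u = prr b ∘ v -> u = v.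
Proof.
by move=> hl hr; rewrite (biproduct_decomp u) (biproduct_decomp v) hl hr.
Qed.

Lemma biproduct_coext X Y W (b : biproduct X Y) (u v : hom b W) :
  u ∘ binl b = v ∘ binl b -> u ∘ binr b = v ∘ binr b -> u = v.
Proof.
move=> hl hr; rewrite -(comp_idr u) -(comp_idr v) -(biproduct_id b) !compDr.
by rewrite !comp_assoc hl hr.
Qed.

Definition bswap X Y (b : biproduct X Y) : biproduct Y X :=
  @Biproduct A Y X b (binr b) (binl b) (prr b) (prl b) (prr_binr b)
    (prl_binl b) (prr_binl b) (prl_binr b)
    (etrans (addrC _ _) (biproduct_id b)).

Lemma prl_kernel X Y (b : biproduct X Y) : is_kernel (prl b) (binr b).
Proof.
apply: is_kernelP; first exact: prl_binr.
  by apply: monic0 => W u e; rewrite -(prrK b u) e comp0r.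
move=> W u e; exists (prr b ∘ u).
by rewrite [RHS](biproduct_decomp u) e comp0r add0r.
Qed.

End Preadditive.

Lemma cokernel_epic (A : preadditive) (X Y Q : A) (f : hom X Y) (q : hom Y Q) :
  is_cokernel f q -> forall (W : A) (u v : hom Q W), u ∘ q = v ∘ q -> u = v.
Proof. by move=> h; apply: (@kernel_monic (op_preadditive A) _ _ _ f q h). Qed.

Lemma cokernel_unique (A : preadditive) (X Y Q Q' : A) (f : hom X Y)
    (q : hom Y Q) (q' : hom Y Q') :
  is_cokernel f q -> is_cokernel f q' ->
  exists2 a : hom Q Q', is_iso a & a ∘ q = q'.
Proof.
move=> h h'.
by have [a /op_is_iso] := @kernel_unique (op_preadditive A) _ _ _ _ f q' q h' h; exists a.
Qed.

Lemma prr_cokernel (A : preadditive) (X Y : A) (b : biproduct X Y) :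
  is_cokernel (binl b) (prr b).
Proof. exact: (@prl_kernel (op_preadditive A) X Y (op_biproduct b)). Qed.

Lemma prl_cokernel (A : preadditive) (X Y : A) (b : biproduct X Y) :
  is_cokernel (binr b) (prl b).
Proof. exact: (prr_cokernel (bswap b)). Qed.

Section Exact.
Variable E : exact_category.
Implicit Types X Y Z W : E.

(** An admissible monomorphism starts some short exact sequence; its cokernel there is isomorphic to
    the given one, and [ses] is closed under isomorphism. *)
Lemma ses_of_cokernel X Y Z (i : hom X Y) (p : hom Y Z) :
  adm_mono i -> is_cokernel i p -> ses i p.
Proof.
case=> Z' [p' hp'] hp.
have [c ic hc] := cokernel_unique (ses_cokernel hp') hp.
apply: (ses_iso (is_iso_id X) (is_iso_id Y) ic _ _ hp').
  by rewrite comp_idl comp_idr.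
by rewrite hc comp_idr.
Qed.

(** The axiom provides one pushout in which the opposite map is admissible. Any other pushout of the
    same span is isomorphic to it. *)
Lemma adm_mono_pushout_square X Y X' Y' (i : hom X Y) (f : hom X X')
    (i' : hom X' Y') (f' : hom Y Y') :
  is_pushout i f i' f' -> adm_mono i -> adm_mono i'.
Proof.
move=> [e he] hi.
have [V [j [g [[e' he'] [Z [p hp]]]]]] := adm_mono_pushout f hi.
have [a [[aj ag] _]] := he' _ _ _ e.
have [b [[bi bf] _]] := he _ _ _ e'.
have ab : a ∘ b = idm Y'.
  have [w [_ hw]] := he _ _ _ e.
  by rewrite -(hw (a ∘ b)) ?(hw (idm Y')) // ?comp_idl // -!comp_assoc bi bf.
have ba : b ∘ a = idm V.
  have [w [_ hw]] := he' _ _ _ e'.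
  by rewrite -(hw (b ∘ a)) ?(hw (idm V)) // ?comp_idl // -!comp_assoc aj ag.
exists Z, (p ∘ b).
apply: (ses_iso (is_iso_id X') (_ : is_iso a) (is_iso_id Z) _ _ hp).
- by exists b.
- by rewrite aj comp_idr.
- by rewrite comp_idl -comp_assoc ba comp_idr.
Qed.

(** The kernel [i] of the admissible epimorphism [idm X] is monic and zero, so its source [K] is a
    zero object and [i] is an admissible map from zero to [X]. The inclusion [binr b] is its pushout
    along the zero map from [K] to [Y]. *)
Lemma biproduct_ses X Y (b : biproduct X Y) : ses (binr b) (prl b).
Proof.
apply: ses_of_cokernel (prl_cokernel b).
have [K [i hi]] := adm_epi_id X.
have i0 : i = 0 by have [e _] := ses_kernel hi; rewrite -(comp_idl i).
have K0 W (u : hom K W) : u = 0.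
  have id0 : idm K = 0.
    by apply: (kernel_monic (ses_kernel hi)); rewrite i0 !comp0l.
  by rewrite -(comp_idr u) id0 comp0r.
apply: (@adm_mono_pushout_square _ _ _ _ i 0 _ (binl b)); last by exists X, (idm X).
split; first by rewrite i0 !comp0r.
move=> W u v _; exists (u ∘ prr b + v ∘ prl b); split.
  rewrite !compDl -!comp_assoc prr_binr prl_binr prr_binl prl_binl.
  by rewrite !comp0r !comp_idr addr0 add0r.
move=> w [<- <-]; rewrite -!comp_assoc -compDr addrC.
by rewrite biproduct_id comp_idr.
Qed.

Lemma binr_adm_mono X Y (b : biproduct X Y) : adm_mono (binr b).
Proof. by exists X, (prl b); apply: biproduct_ses. Qed.

End Exact.

Lemma adm_epi_pullback_square (E : exact_category) (Y Z Z' Y' : E)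
    (p : hom Y Z) (f : hom Z' Z) (p' : hom Y' Z') (f' : hom Y' Y) :
  is_pullback p' f' f p -> adm_epi p -> adm_epi p'.
Proof. exact: (@adm_mono_pushout_square (op_exact E)). Qed.

Section Exact2.
Variable E : exact_category.
Implicit Types X Y Z W : E.

Lemma split_epi_ses X Y K (r : hom X Y) (s : hom Y X) (k : hom K X) :
  r ∘ s = idm Y -> is_kernel r k -> ses k r.
Proof.
move=> rs hk.
have [|q hq] := kernel_lift hk (_ : r ∘ (idm X - s ∘ r : hom X X) = 0).
  by rewrite (compDr r) (compNr r) comp_assoc rs comp_idr comp_idl subrr.
have qk : q ∘ k = idm K.
  apply: (kernel_monic hk); rewrite comp_assoc hq comp_idr.
  by rewrite (compDl (idm X)) (compNl (s ∘ r)) -comp_assoc hk.1 comp0r subr0 comp_idl.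
have qs : q ∘ s = 0.
  apply: (kernel_monic hk); rewrite comp_assoc hq comp0r.
  by rewrite (compDl (idm X)) (compNl (s ∘ r)) -comp_assoc rs comp_idl comp_idr subrr.
have bid : s ∘ r + k ∘ q = idm X by rewrite hq addrC subrK.
exact: (biproduct_ses (Biproduct rs qk hk.1 qs bid)).
Qed.

Lemma adm_epi_epic X Y W (p : hom X Y) (u v : hom Y W) :
  adm_epi p -> u ∘ p = v ∘ p -> u = v.
Proof. by case=> K [i /ses_cokernel/cokernel_epic]; apply. Qed.

(* Bühler, "Exact categories", Proposition 7.6. *)
Lemma adm_epi_cancel X Y Z (q : hom Y Z) (v : hom X Y) :
  weakly_idempotent_complete E -> adm_epi (q ∘ v) -> adm_epi q.
Proof.
move=> wic hqv.
(* The pullback of [q ∘ v] along [q] projects to [X] with a section induced by [v]. Weak idempotent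
   completeness gives this split epimorphism a kernel, so [pX] is admissible, and so is [q ∘ pY],
   which equals [q ∘ v ∘ pX]. *)
have [P [pY [pX [[sq hP] hpY]]]] := adm_epi_pullback q hqv.
have [s [[sY sX] _]] := hP _ v (idm X) (esym (comp_idr _)).
have [K [k hk]] := wic _ _ pX (ex_intro _ s sX).
have hpX : adm_epi pX by exists K, k; apply: split_epi_ses sX hk.
have hqP : adm_epi (q ∘ pY) by rewrite sq; apply: adm_epi_comp hqv hpX.
have hN : is_kernel q (pY ∘ k).
  split; first by rewrite comp_assoc sq -comp_assoc hk.1 comp0r.
  move=> W u qu0.
  have [|w [[wY wX] uw]] := hP W u 0; first by rewrite qu0 comp0r.
  have [t [ht ut]] := hk.2 _ _ wX; exists t; split.
    by rewrite -comp_assoc ht.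
  move=> t' ht'; apply: ut; apply/esym/uw; rewrite !comp_assoc ht' hk.1 comp0l.
  by split.
have [M [m hm]] := hqP.
have mono_n := kernel_monic hN.
have [|a ha] := kernel_lift hN (_ : q ∘ (pY ∘ m) = 0).
  by rewrite comp_assoc (ses_kernel hm).1.
(* The short exact sequence of [q ∘ pY] descends along [pY]: the map [a] is the pullback of [pY]
   along the kernel [pY ∘ k] of [q], and this kernel is in turn the pushout of [m] along [a], hence
   an admissible monomorphism. *)
have ea : adm_epi a.
  apply: (@adm_epi_pullback_square _ _ _ _ _ pY (pY ∘ k) _ m _ hpY).
  split=> // W u w uw.
  have [|t ht] := kernel_lift (ses_kernel hm) (_ : (q ∘ pY) ∘ w = 0).
    by rewrite -comp_assoc -uw comp_assoc hN.1 comp0l.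
  exists t; split.
    by split=> //; apply: mono_n; rewrite uw comp_assoc ha -comp_assoc ht.
  by move=> t' [_ ht']; apply: (kernel_monic (ses_kernel hm)); rewrite ht.
have hn : adm_mono (pY ∘ k).
  apply: (@adm_mono_pushout_square _ _ _ _ _ m a _ pY); last by exists Z, (q ∘ pY).
  split=> // W u w uw.
  have [R [rho hrho]] := hpY.
  have prho := (ses_kernel hrho).1.
  have wrho : w ∘ rho = 0.
    have [|rho' hr] := kernel_lift (ses_kernel hm) (_ : (q ∘ pY) ∘ rho = 0).
      by rewrite -comp_assoc prho comp0r.
    rewrite -hr comp_assoc -uw -comp_assoc (_ : a ∘ rho' = 0) ?comp0r //.
    by apply: mono_n; rewrite comp_assoc ha -comp_assoc hr prho comp0r.
  have [c [hc _]] := (ses_cokernel hrho).2 _ _ wrho.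
  exists c; split.
    by split=> //; apply: (adm_epi_epic ea); rewrite -comp_assoc ha comp_assoc hc.
  by move=> c' [_ hc']; apply: (adm_epi_epic hpY); rewrite hc.
exists K, (pY ∘ k); apply: ses_of_cokernel hn _; split; first exact: hN.1.
move=> W u un.
have [|c [hc _]] := (ses_cokernel hm).2 W (u ∘ pY) _.
  by rewrite -comp_assoc -ha comp_assoc un comp0l.
exists c; split; first by apply: (adm_epi_epic hpY); rewrite -comp_assoc.
by move=> c' hc'; apply: (adm_epi_epic hqP); rewrite hc comp_assoc hc'.
Qed.

End Exact2.

(** The idempotent [idm X - r ∘ s] factors through the kernel of [s], and the first factor is a
    cokernel of [r]. Hence weak idempotent completeness is self-dual. *)
Lemma section_cokernel (A : preadditive) (X Y : A) (r : hom Y X) (s : hom X Y) :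
  weakly_idempotent_complete A -> s ∘ r = idm Y ->
  exists (K : A) (q : hom X K), is_cokernel r q.
Proof.
move=> wic sr; have [K [k hk]] := wic _ _ _ (ex_intro _ _ sr).
have [|q hq] := kernel_lift hk (_ : s ∘ (idm X - r ∘ s : hom X X) = 0).
  by rewrite (compDr s) (compNr s) comp_assoc sr comp_idr comp_idl subrr.
exists K, q; split.
  apply: (kernel_monic hk); rewrite comp_assoc hq comp0r.
  by rewrite (compDl (idm X)) (compNl (r ∘ s)) -comp_assoc sr comp_idl comp_idr subrr.
move=> W u ur.
have qk : q ∘ k = idm K.
  apply: (kernel_monic hk); rewrite comp_assoc hq comp_idr.
  by rewrite (compDl (idm X)) (compNl (r ∘ s)) -comp_assoc hk.1 comp0r subr0 comp_idl.
exists (u ∘ k); split; last by move=> v <-; rewrite -comp_assoc qk comp_idr.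
by rewrite -comp_assoc hq (compDr u) (compNr u) comp_assoc ur comp0l comp_idr subr0.
Qed.

Lemma op_wic (A : preadditive) :
  weakly_idempotent_complete A -> weakly_idempotent_complete (op_preadditive A).
Proof.
move=> wic X Y r [s rs].
exact: (@section_cokernel A X Y r s wic rs).
Qed.

Lemma adm_mono_cancel (E : exact_category) (X Y Z : E) (f : hom X Y) (g : hom Y Z) :
  weakly_idempotent_complete E -> adm_mono (g ∘ f) -> adm_mono f.
Proof. by move/op_wic=> wic; apply: (@adm_epi_cancel (op_exact E) Z Y X f g wic). Qed.

(** The map [h] acts as [f] and [g] on the two summands, so it is [h1], which applies [f] on the
    left, followed by [h2], which applies [g] on the right. Each factor is a pushout of [f] or [g]
    along a summand inclusion. *)
Lemma biproduct_map_adm_mono (E : exact_category) (X Y X' Y' : E)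
    (b : biproduct X Y) (b' : biproduct X' Y') (f : hom X X') (g : hom Y Y')
    (h : hom b b') :
  prl b' ∘ h = f ∘ prl b -> prr b' ∘ h = g ∘ prr b ->
  adm_mono f -> adm_mono g -> adm_mono h.
Proof.
pose c := biprod X' Y.
move=> hl hr hf hg.
pose h1 : hom b c := binl c ∘ (f ∘ prl b) + binr c ∘ prr b.
pose h2 : hom c b' := binl b' ∘ prl c + binr b' ∘ (g ∘ prr c).
have -> : h = h2 ∘ h1.
  apply: biproduct_ext; rewrite comp_assoc /h2 compDr ?prlK ?prl_binr0 ?prrK ?prr_binl0.
    by rewrite addr0 /h1 compDr prlK prl_binr0 addr0.
  by rewrite add0r /h1 -comp_assoc compDr prrK prr_binl0 add0r.
have h1l : h1 ∘ binl b = binl c ∘ f.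
  by rewrite /h1 compDl -!comp_assoc prl_binl prr_binl comp_idr comp0r addr0.
have h1r : h1 ∘ binr b = binr c.
  by rewrite /h1 compDl -!comp_assoc prl_binr prr_binr comp_idr !comp0r add0r.
have h2l : h2 ∘ binl c = binl b'.
  by rewrite /h2 compDl -!comp_assoc prl_binl prr_binl comp_idr !comp0r addr0.
have h2r : h2 ∘ binr c = binr b' ∘ g.
  by rewrite /h2 compDl -!comp_assoc prl_binr prr_binr comp_idr !comp0r add0r.
apply: adm_mono_comp.
  apply: (@adm_mono_pushout_square _ _ _ _ _ g (binr c) _ (binr b') _ hg).
  split=> // W u v uv; exists (u ∘ (binl c ∘ prl b') + v ∘ prr b'); split.
    split; last first.
      by rewrite compDl -!comp_assoc prl_binr prr_binr !comp0r comp_idr add0r.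
    rewrite compDl -!comp_assoc; apply: (biproduct_coext (b := c)).
      rewrite compDl -!comp_assoc h2l prl_binl prr_binl !comp0r comp_idr.
      by rewrite addr0.
    rewrite compDl -!comp_assoc h2r prl_binr0 prrK !comp0r add0r.
    by rewrite uv.
  move=> w [hw <-]; apply: (biproduct_coext (b := b')).
    rewrite compDl -!comp_assoc prl_binl prr_binl !comp0r comp_idr addr0.
    by rewrite -hw -comp_assoc h2l.
  by rewrite compDl -!comp_assoc prl_binr prr_binr !comp0r comp_idr add0r.
apply: (@adm_mono_pushout_square _ _ _ _ _ f (binl b) _ (binl c) _ hf).
split=> // W u v uv; exists (v ∘ prl c + u ∘ (binr b ∘ prr c)); split.
  split; last first.
    by rewrite compDl -!comp_assoc prl_binl prr_binl !comp0r comp_idr addr0.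
  rewrite compDl -!comp_assoc; apply: (biproduct_coext (b := b)).
    rewrite compDl -!comp_assoc h1l prlK prr_binl0 !comp0r addr0.
    by rewrite uv.
  rewrite compDl -!comp_assoc h1r prl_binr prr_binr !comp0r comp_idr.
  by rewrite add0r.
move=> w [hw <-]; apply: (biproduct_coext (b := c)).
  by rewrite compDl -!comp_assoc prl_binl prr_binl !comp0r comp_idr addr0.
rewrite compDl -!comp_assoc prl_binr prr_binr !comp0r comp_idr add0r.
by rewrite -hw -comp_assoc h1r.
Qed.

(** * Sequential colimits and split idempotents *)

Section Colimits.
Variable C : category.
Implicit Type X : omega_diagram C.

Lemma colimit_ext X L W (c : forall n, hom (X n) L) (u v : hom L W) :
  is_colimit c -> (forall n, u ∘ c n = v ∘ c n) -> u = v.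
Proof.
case=> cc uc e; have [|w [_ hw]] := uc W (fun n => v ∘ c n).
  by move=> n; rewrite -comp_assoc cc.
by rewrite -(hw u e) (hw v).
Qed.

Lemma colimit_lift X L (c : forall n, hom (X n) L) (hc : is_colimit c)
    W (u : forall n, hom (X n) W) :
  is_cocone u -> exists w : hom L W, forall n, w ∘ c n = u n.
Proof. by case: hc => _ h /h [w [hw _]]; exists w. Qed.

Lemma colimitP X L (c : forall n, hom (X n) L) :
  is_cocone c ->
  (forall W (u : forall n, hom (X n) W), is_cocone u ->
     exists w : hom L W, forall n, w ∘ c n = u n) ->
  (forall W (u v : hom L W), (forall n, u ∘ c n = v ∘ c n) -> u = v) ->
  is_colimit c.
Proof.
move=> cc h1 h2; split=> // W u /h1 [w hw]; exists w; split=> // w' hw'.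
by apply: h2 => n; rewrite hw hw'.
Qed.

Lemma colimit_unique X L L' (c : forall n, hom (X n) L)
    (c' : forall n, hom (X n) L') :
  is_colimit c -> is_colimit c' ->
  exists2 a : hom L L', is_iso a & forall n, a ∘ c n = c' n.
Proof.
move=> hc hc'.
have [a ha] := colimit_lift hc hc'.1; have [b hb] := colimit_lift hc' hc.1.
exists a => //; exists b; split.
  by apply: (colimit_ext hc) => n; rewrite -comp_assoc ha hb comp_idl.
by apply: (colimit_ext hc') => n; rewrite -comp_assoc hb ha comp_idl.
Qed.

End Colimits.

(** * Sequences of split monomorphisms and countable coproducts *)

Section SplitSequence.
Variables (A : preadditive) (Z : omega_diagram A) (P : nat -> A).
Variables (a : forall n, hom (P n) (Z n.+1)).
Variables (r : forall n, hom (Z n.+1) (P n)) (q : forall n, hom (Z n.+1) (Z n)).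
Hypothesis ra : forall n, r n ∘ a n = idm (P n).
Hypothesis qi : forall n, q n ∘ dmap Z n = idm (Z n).
Hypothesis ri : forall n, r n ∘ dmap Z n = 0.
Hypothesis qa : forall n, q n ∘ a n = 0.
Hypothesis arq : forall n, a n ∘ r n + dmap Z n ∘ q n = idm (Z n.+1).

(** [Z n] is the sum of [Z 0] and the complements [P m] with [m < n]. The index of [P] is shifted by
    one to leave place [0] for [Z 0]. *)
Definition split_summand (n : nat) : A := if n is m.+1 then P m else Z 0%N.

Definition split_inj (L : A) (c : forall n, hom (Z n) L) (n : nat) :
    hom (split_summand n) L :=
  match n with 0 => c 0%N | m.+1 => c m.+1 ∘ a m end.

(** Maps given on the summands assemble into a cocone [v] by recursion along the decomposition of
    [Z n.+1] as [P n] plus [Z n]. *)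
Lemma split_colimit_coproduct (L : A) (c : forall n, hom (Z n) L) :
  is_colimit c -> is_coproduct (split_inj c).
Proof.
move=> hc W u.
pose v := fix v n : hom (Z n) W := match n with
  0 => u 0%N | m.+1 => u m.+1 ∘ r m + v m ∘ q m end.
have [|w hw] := colimit_lift (u := v) hc.
  move=> n; rewrite /=. rewrite compDl -!comp_assoc ri qi comp0r add0r comp_idr.
  by [].
exists w; split.
  case=> [|n] /=; first exact: hw.
  by rewrite comp_assoc hw /= compDl -!comp_assoc ra qa comp0r addr0 comp_idr.
move=> w' hw'; apply: (colimit_ext hc) => n; rewrite hw.
elim: n => [|n IH]; first exact: (esym (hw' 0%N)).
have -> : v n.+1 = u n.+1 ∘ r n + v n ∘ q n by [].
rewrite IH -[RHS]comp_idr -(arq n) compDr !comp_assoc.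
by rewrite -(comp_assoc w' (c _) (dmap _ _)) hc.1 -(comp_assoc w' (c _) (a _)) -(hw'
  n.+1).
Qed.

Lemma split_coproduct_colimit (L : A) (c : forall n, hom (Z n) L) :
  is_cocone c -> is_coproduct (split_inj c) -> is_colimit c.
Proof.
move=> cc hc; split=> // W u cu.
have [w [hw uw]] := hc W (split_inj u).
exists w; split; last first.
  move=> w' hw'; apply: uw; case=> [|n] /=; first exact: hw'.
  by rewrite comp_assoc hw'.
elim=> [|n IH]; first exact: (hw 0%N).
rewrite -(comp_idr (w ∘ c n.+1)) -(comp_idr (u n.+1)) -(arq n) !compDr.
rewrite !comp_assoc -(comp_assoc w (c _) (dmap _ _)) cc cu IH.
by rewrite -(comp_assoc w (c _) (a _)) (hw n.+1).
Qed.

End SplitSequence.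

Definition split_mono (A : preadditive) (Z Z' : A) (i : hom Z Z') : Prop :=
  exists (P : A) (a : hom P Z') (r : hom Z' P) (q : hom Z' Z),
    [/\ r ∘ a = idm P, q ∘ i = idm Z, r ∘ i = 0, q ∘ a = 0
      & a ∘ r + i ∘ q = idm Z'].

Lemma binr_split_mono (A : preadditive) (X Y : A) (b : biproduct X Y) :
  split_mono (binr b).
Proof.
by exists X, (binl b), (prl b), (prr b); split;
  [apply: prl_binl|apply: prr_binr|apply: prl_binr|apply: prr_binl|apply: biproduct_id].
Qed.

Lemma split_mono_adm (E : exact_category) (X Y : E) (i : hom X Y) :
  split_mono i -> adm_mono i.
Proof.
move=> [P [a [r [q [ra qi ri qa arq]]]]].
exact: (binr_adm_mono (Biproduct ra qi ri qa arq)).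
Qed.

Lemma fmap_split_mono (A B : preadditive) (F : additive_functor A B) (X Y : A)
    (i : hom X Y) : split_mono i -> split_mono (fmap F i).
Proof.
move=> [P [a [r [q [ra qi ri qa arq]]]]].
exists (F P), (fmap F a), (fmap F r), (fmap F q).
by split; rewrite -!(fmap_comp F) -?(fmapD F) ?ra ?qi ?ri ?qa ?arq ?(fmap_id F)
  ?additive_functor0.
Qed.

(** This is how preservation of countable coproducts is used. The colimit is the coproduct of the
    successive complements; [F] preserves this coproduct and, being additive, also the splittings,
    and the coproduct is then read back as a colimit. *)
Lemma fmap_split_colimit (A B : preadditive) (F : additive_functor A B)
    (Z : omega_diagram A) (L : A) (c : forall n, hom (Z n) L) :
  preserves_countable_coproducts F -> (forall n, split_mono (dmap Z n)) ->
  is_colimit c ->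
  is_colimit (X := @OmegaDiagram B (fun n => F (Z n)) (fun n => fmap F (dmap Z n)))
    (fun n => fmap F (c n)).
Proof.
move=> hF /dep_choice [P /dep_choice [a /dep_choice [r /dep_choice [q h]]]] hc.
have ra n : r n ∘ a n = idm (P n) by have [] := h n.
have qi n : q n ∘ dmap Z n = idm (Z n) by have [] := h n.
have ri n : r n ∘ dmap Z n = 0 by have [] := h n.
have qa n : q n ∘ a n = 0 by have [] := h n.
have arq n : a n ∘ r n + dmap Z n ∘ q n = idm (Z n.+1) by have [] := h n.
have hcop := hF nat _ _ _ (split_colimit_coproduct ra qi ri qa arq hc).
pose FZ := @OmegaDiagram B (fun n => F (Z n)) (fun n => fmap F (dmap Z n)).
have Farq n : fmap F (a n) ∘ fmap F (r n) + fmap F (dmap Z n) ∘ fmap F (q n) = idm (F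
  (Z n.+1)).
  by rewrite -!(fmap_comp F) -(fmapD F) arq (fmap_id F).
apply: (@split_coproduct_colimit B FZ (fun n => F (P n)) (fun n => fmap F (a n))
  (fun n => fmap F (r n)) (fun n => fmap F (q n)) Farq).
  by move=> n; rewrite -(fmap_comp F) hc.1.
move=> W u.
(* The image of a summand and the summand of the image sequence agree only after a case analysis on
   [n], hence the annotated [match]. *)
have [w [hw uw]] := hcop W (fun n => match n return
   hom (F (@split_summand A Z P n)) W with
   0 => u 0%N | m.+1 => u m.+1 end).
exists w; split.
  by case=> [|n]; [exact: (hw 0%N)|have := hw n.+1; rewrite /= (fmap_comp F)].
move=> w' hw'; apply: uw; case=> [|n]; first exact: (hw' 0%N).
by rewrite -(hw' n.+1) /= (fmap_comp F).
Qed.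

Section Idempotents.
Variable E : exact_category.

(** The finite powers of [X] form a sequence of split inclusions. Its colimit exists because these
    are admissible monomorphisms, and it is the coproduct of the complements, all equal to [X]. *)
Lemma countable_power (X : E) :
  weakly_omega_AdMon_elementary E ->
  exists (S : E) (i : nat -> hom X S), is_coproduct (fun n => i n).
Proof.
move=> [hE _].
pose Zo := fix Zo n : E := match n with 0 => X | m.+1 => biprod X (Zo m) end.
pose Z := @OmegaDiagram E Zo (fun n => binr (biprod X (Zo n))).
have [L [c hc]] := hE Z (fun n => binr_adm_mono (biprod X (Zo n))).
have hcop := @split_colimit_coproduct E Z (fun=> X) (fun n => binl (biprod X (Zo n)))
  (fun n => prl (biprod X (Zo n))) (fun n => prr (biprod X (Zo n)))
  (fun n => prl_binl _) (fun n => prr_binr _) (fun n => prl_binr _)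
  (fun n => prr_binl _) (fun n => biproduct_id _) L c hc.
exists L, (fun n => match n with 0 => c 0%N 
  | m.+1 => c m.+1 ∘ (binl (biprod X (Zo m)) : hom X (Z m.+1)) end).
move=> W u.
have [w [hw uw]] := hcop W (fun n => match n return hom (@split_summand E Z (fun=> X)
  n) W with 0 => u 0%N | m.+1 => u m.+1 end).
exists w; split; first by case=> [|n]; [exact: (hw 0%N) | exact: (hw n.+1)].
by move=> w' hw'; apply: uw; case=> [|n]; [exact: (hw' 0%N) | exact: (hw' n.+1)].
Qed.

(* Eilenberg swindle: for [e] idempotent on [X], the shift of the image of [e] on
   a countable power of [X] is split mono with complement that image. *)
Lemma idempotent_split (X : E) (e : hom X X) :
  weakly_idempotent_complete E -> weakly_omega_AdMon_elementary E ->
  e ∘ e = e ->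
  exists (Y : E) (r : hom X Y) (s : hom Y X), r ∘ s = idm Y /\ s ∘ r = e.
Proof.
move=> wic /(countable_power X) [S [i hS]] ee.
have Sext W (u v : hom S W) : (forall n, u ∘ i n = v ∘ i n) -> u = v.
  by move=> h; have [w [_ hw]] := hS W (fun n => v ∘ i n); rewrite -(hw u h) (hw v).
pose e' : hom X X := idm X - e.
have ee' : e ∘ e' = 0 by rewrite /e' (compDr e) (compNr e) ee comp_idr subrr.
have e'e : e' ∘ e = 0 by rewrite /e' (compDl (idm X)) (compNl e) ee comp_idl subrr.
have e'e' : e' ∘ e' = e' by rewrite {1}/e' (compDl (idm X)) (compNl e) ee' comp_idl subr0.
have eDe' : e + e' = idm X by rewrite /e' addrC subrK.
(* [sigma] moves the [e]-part of each copy of [X] to the next copy and fixes the [e']-part. [rho]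
   moves it back and kills the [e]-part of copy [0]. *)
have [sigma [hs _]] := hS S (fun n => i n.+1 ∘ e + i n ∘ e').
have [rho [hr _]] := hS S (fun n => match n with
  0 => i 0%N ∘ e' | m.+1 => i m ∘ e + i m.+1 ∘ e' end).
have [p0 [hp _]] := hS X (fun n => match n with 0 => idm X | _ => 0 end).
have rs : rho ∘ sigma = idm S.
  apply: Sext => n; rewrite -comp_assoc hs comp_idl compDr !comp_assoc hr.
  rewrite compDl -!comp_assoc ee e'e comp0r addr0.
  case: n => [|n] /=.
    by rewrite comp_assoc hr -comp_assoc e'e' -compDr eDe' comp_idr.
  by rewrite (comp_assoc rho) hr compDl -!comp_assoc ee' e'e' comp0r add0r -compDr eDe'
    comp_idr.
(* The kernel of [rho] splits the idempotent [idm S - sigma ∘ rho]. By [hq'] below this idempotent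
   is [e] on copy [0] and zero on all others, so the same object splits [e]. *)
have [K [k hk]] := wic _ _ _ (ex_intro _ _ rs).
have [|q hq] := kernel_lift hk (_ : rho ∘ (idm S - sigma ∘ rho : hom S S) = 0).
  by rewrite (compDr rho) (compNr rho) comp_assoc rs comp_idr comp_idl subrr.
have hq' : k ∘ q = i 0%N ∘ (e ∘ p0).
  apply: Sext => n; rewrite hq (compDl (idm S)) (compNl (sigma ∘ rho)) -!comp_assoc hr hp.
  case: n => [|n]; rewrite comp_idl.
    by rewrite comp_assoc hs compDl -!comp_assoc ee' e'e' comp0r add0r !comp_idr
      -{1}(comp_idr (i 0%N)) -eDe' compDr addrK.
  rewrite !comp0r compDr !comp_assoc !hs !compDl -!comp_assoc ee e'e ee' e'e'.
  by rewrite !comp0r addr0 add0r -compDr eDe' comp_idr subrr.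
have mk := kernel_monic hk.
exists K, (q ∘ i 0%N), (p0 ∘ k); split.
  apply: mk; rewrite !comp_assoc hq' comp_idr.
  have hqk : i 0%N ∘ (e ∘ p0) ∘ k = k.
    by rewrite -hq' hq (compDl (idm S)) (compNl (sigma ∘ rho)) -comp_assoc hk.1 comp0r
      subr0 comp_idl.
  rewrite -!comp_assoc (comp_assoc p0) hp comp_idl.
  by rewrite -[RHS]hqk -!comp_assoc.
rewrite -!comp_assoc (comp_assoc k) hq' -!comp_assoc hp comp_idr.
by rewrite comp_assoc hp comp_idl.
Qed.

End Idempotents.

(** * Acyclic complexes *)

Section Exactness.
Variable E : exact_category.
Hypothesis wic : weakly_idempotent_complete E.
Implicit Types (X Y Z : complex E) (n : int).

Definition has_kernel (U V : E) (f : hom U V) : Prop :=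
  exists (K : E) (k : hom K U), is_kernel f k.

(** Exactness in degree [n - 1] in terms of generalized elements: a cycle becomes a boundary after
    precomposition with an admissible epimorphism. This form permits diagram chases. *)
Definition locally_exact X n : Prop :=
  forall (W : E) (u : hom W (X (n - 1))), diff X (n - 1) ∘ u = 0 ->
  exists (W' : E) (e : hom W' W) (v : hom W' (X n)),
    adm_epi e /\ diff X n ∘ v = u ∘ e.

Definition exact_at X n : Prop :=
  has_kernel (diff X (n - 1)) /\ locally_exact X n.

Lemma acyclic_exact X n : acyclic X -> exact_at X n.
Proof.
case=> Z [i [p h]].
have [d_n ses_n] := h n; have [d_n' ses_n'] := h (n - 1).
have mi m : monic (i m) by have [_ s] := h m; exact: kernel_monic (ses_kernel s).
have hk : is_kernel (diff X (n - 1)) (i (n - 1)).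
  rewrite d_n'; apply: kernel_monic_comp; [exact: mi|exact: ses_kernel].
split; first by exists (Z (n - 1)), (i (n - 1)).
move=> W u /(kernel_lift hk) [u' hu'].
have [|W' [e [v [[sq _] he]]]] := @adm_epi_pullback E _ _ W (p n) u'.
  by exists (Z n), (i n).
by exists W', e, v; split=> //; rewrite d_n -hu' -comp_assoc -sq comp_assoc.
Qed.

(** The data may be chosen separately in each degree. The kernel of [p (n - 1)] and the object [K n]
    are both kernels of [diff X (n - 1)], and the isomorphism between them glues the choices into
    one family of cycle objects. *)
Lemma acyclic_factorization X :
  (forall n, exists (K : E) (k : hom K (X (n - 1))) (p : hom (X n) K),
     [/\ is_kernel (diff X (n - 1)) k, adm_epi p & diff X n = k ∘ p]) ->
  acyclic X.
Proof.
move=> /dep_choice [K] /dep_choice [k] /dep_choice [p h].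
have /dep_choice [Z /dep_choice [i ses_i]] :
    forall n, exists (Z : E) (i : hom Z (X n)), ses i (p n).
  by move=> n; have [_ [Z [i hi]] _] := h n; exists Z, i.
have /dep_choice [a ha] : forall n, exists a : hom (K n) (Z (n - 1)),
    is_iso a /\ i (n - 1) ∘ a = k n.
  move=> n; have [hk _ _] := h n; have [hk' _ dp] := h (n - 1).
  have hi : is_kernel (diff X (n - 1)) (i (n - 1)).
    rewrite dp; apply: kernel_monic_comp; first exact: kernel_monic hk'.
    exact: ses_kernel.
  by have [a] := kernel_unique hk hi; exists a.
exists Z, i, (fun n => a n ∘ p n) => n; have [iso_a e] := ha n; split.
  by rewrite comp_assoc e; have [] := h n.
apply: (ses_iso (is_iso_id _) (is_iso_id _) iso_a _ _ (ses_i n)).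
  by rewrite comp_idl comp_idr.
by rewrite comp_idr.
Qed.

(** Local exactness applied to the universal cycle [k] shows that [p ∘ v] is an admissible
    epimorphism, where [p] is the corestriction of the differential; then [p] is one by
    [adm_epi_cancel]. *)
Lemma exact_acyclic X : (forall n, exact_at X n) -> acyclic X.
Proof.
move=> h; apply: acyclic_factorization => n; have [[K [k hk]] hl] := h n.
have [W' [e [v [he dv]]]] := hl K k hk.1.
have [p hp] := kernel_lift hk (diff_diff X n).
exists K, k, p; split=> //.
apply: (@adm_epi_cancel E _ _ _ p v wic).
suff -> : p ∘ v = e by [].
by apply: (kernel_monic hk); rewrite comp_assoc hp.
Qed.

Lemma acyclicP X : acyclic X <-> forall n, exact_at X n.
Proof. by split=> [h n|]; [exact: acyclic_exact|exact: exact_acyclic]. Qed.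

Hypothesis elem : weakly_omega_AdMon_elementary E.

(** Local exactness passes to a retract at once. A kernel of the differential of [X] has to be a
    retract of the kernel [K] for [Y]: the composite [a ∘ b] induces an idempotent [eps] on [K], and
    the object splitting it is the required kernel. *)
Lemma acyclic_retract X Y (a : chain_map X Y) (b : chain_map Y X) :
  (forall n, b n ∘ a n = idm (X n)) -> acyclic Y -> acyclic X.
Proof.
move=> ba /acyclicP hY; apply/acyclicP => n.
have [[K [k hk]] hl] := hY n; split; last first.
  move=> W u du.
  have [|W' [e [v [he dv]]]] := hl W (a (n - 1) ∘ u).
    by rewrite comp_assoc -chain_mapP -comp_assoc du comp0r.
  exists W', e, (b n ∘ v); split=> //.
  by rewrite comp_assoc -chain_mapP -comp_assoc dv !comp_assoc ba comp_idl.
have [|eps heps] := kernel_lift (u := a (n - 1) ∘ (b (n - 1) ∘ k)) hk.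
  by rewrite comp_assoc -chain_mapP -comp_assoc (comp_assoc (diff X _)) -chain_mapP
    -comp_assoc hk.1 !comp0r.
have mk := kernel_monic hk.
have keps W (x : hom W K) : a (n - 1) ∘ (b (n - 1) ∘ (k ∘ x)) = k ∘ (eps ∘ x).
  by rewrite (comp_assoc k) heps -!comp_assoc.
have [|L [rho [s [rs sr]]]] := idempotent_split (e := eps) wic elem.
  apply: mk; rewrite comp_assoc !heps -!comp_assoc heps.
  by rewrite (comp_assoc (b _) (a _)) ba comp_idl.
exists L, (b (n - 1) ∘ (k ∘ s)).
apply: is_kernelP.
- by rewrite comp_assoc -chain_mapP -!comp_assoc (comp_assoc (diff Y _)) hk.1 comp0l
  comp0r.
- move=> W u v e.
  have : k ∘ (s ∘ u) = k ∘ (s ∘ v).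
    have ks w : a (n - 1) ∘ (b (n - 1) ∘ (k ∘ s) ∘ w) = k ∘ (s ∘ w) :> hom W _.
      by rewrite -!comp_assoc keps -sr -!comp_assoc (comp_assoc rho) rs comp_idl.
    by rewrite -!ks e.
  move/mk => e'; by rewrite -(comp_idl u) -(comp_idl v) -rs -!comp_assoc e'.
- move=> W u du.
  have [|v hv] := kernel_lift (u := a (n - 1) ∘ u) hk.
    by rewrite comp_assoc -chain_mapP -comp_assoc du comp0r.
  exists (rho ∘ v); rewrite -!comp_assoc (comp_assoc s) sr (comp_assoc k) heps.
  by rewrite -!comp_assoc hv (comp_assoc (b _)) ba comp_idl comp_assoc ba comp_idl.
Qed.

End Exactness.

Section Shift.
Variable A : preadditive.

Lemma shift_diff_diff (X : complex A) (n : int) :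
  (- diff X (n - 1 - 1) : hom (X (n - 1 - 1)) (X (n - 1 - 1 - 1))) ∘
  (- diff X (n - 1) : hom (X (n - 1)) (X (n - 1 - 1))) = 0.
Proof. by rewrite (compNl (diff X _)) compNr opprK; apply: diff_diff. Qed.

Definition shift (X : complex A) : complex A :=
  @Complex A (fun n => X (n - 1)) (fun n => - diff X (n - 1))
    (shift_diff_diff X).

End Shift.

Section ShiftExact.
Variable E : exact_category.
Implicit Types (X Y Z : complex E) (n : int).

Lemma exact_at_shift X n : exact_at (shift X) n <-> exact_at X (n - 1).
Proof.
split=> -[[K [k [dk hk]]] hl]; split.
- exists K, k; split.
    by apply/oppr_inj; rewrite oppr0 -compNl.
  by move=> W u du; apply: hk; rewrite compNl du oppr0.
- move=> W u du.
  have [|W' [e [v [he dv]]]] := hl W u; first by rewrite compNl du oppr0.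
  by exists W', e, (- v); split=> //; rewrite compNr -compNl.
- exists K, k; split.
    by rewrite compNl dk oppr0.
  by move=> W u du; apply: hk; apply/oppr_inj; rewrite oppr0 -compNl.
- move=> W u du.
  have [|W' [e [v [he dv]]]] := hl W u.
    by apply/oppr_inj; rewrite oppr0 -compNl.
  by exists W', e, (- v); split=> //; rewrite compNl (compNr (diff X _)) opprK.
Qed.

Lemma acyclic_shift X : weakly_idempotent_complete E ->
  acyclic (shift X) <-> acyclic X.
Proof.
move=> wic; rewrite !acyclicP //; split=> h n; last exact/exact_at_shift.
by have /exact_at_shift := h (n + 1); rewrite addrK.
Qed.

End ShiftExact.

(** * Cones *)

Section Pairing.
Variables (A : preadditive) (X Y : A) (b : biproduct X Y).

Definition bpair (W : A) (u : hom W X) (v : hom W Y) : hom W b :=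
  binl b ∘ u + binr b ∘ v.

Lemma prl_bpair W (u : hom W X) (v : hom W Y) : prl b ∘ bpair u v = u.
Proof. by rewrite compDr prlK prl_binr0 addr0. Qed.

Lemma prr_bpair W (u : hom W X) (v : hom W Y) : prr b ∘ bpair u v = v.
Proof. by rewrite compDr prrK prr_binl0 add0r. Qed.

Lemma bpair_comp W W' (u : hom W X) (v : hom W Y) (w : hom W' W) :
  bpair u v ∘ w = bpair (u ∘ w) (v ∘ w).
Proof. by rewrite /bpair compDl -!comp_assoc. Qed.

Lemma bpairE W (u : hom W b) : u = bpair (prl b ∘ u) (prr b ∘ u).
Proof. exact: biproduct_decomp. Qed.

Lemma bpairN W (u : hom W X) (v : hom W Y) : - bpair u v = bpair (- u) (- v).
Proof. by rewrite /bpair !compNr opprD. Qed.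

Lemma bpairD W (u u' : hom W X) (v v' : hom W Y) :
  bpair u v + bpair u' v' = bpair (u + u') (v + v').
Proof. by rewrite /bpair !compDr addrACA. Qed.

Lemma bpair0 W : bpair (0 : hom W X) (0 : hom W Y) = 0.
Proof. by rewrite /bpair !comp0r addr0. Qed.

Lemma bpair_inj W (u u' : hom W X) (v v' : hom W Y) :
  bpair u v = bpair u' v' -> u = u' /\ v = v'.
Proof.
move=> e; split; first by rewrite -(prl_bpair u v) e prl_bpair.
by rewrite -(prr_bpair u v) e prr_bpair.
Qed.

Lemma eq_bpair_id (u : hom b X) (v : hom b Y) :
  u = prl b -> v = prr b -> bpair u v = idm b.
Proof. by move=> -> ->; rewrite /bpair biproduct_id. Qed.

End Pairing.

Section ConeTheory.
Variable A : additive_category.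
Implicit Types (X Y Z : complex A) (n : int).

Lemma cone_diffE X Y (f : chain_map X Y) n (W : A) (x : hom W (X (n - 1)))
    (y : hom W (Y n)) :
  diff (cone f) n ∘ bpair (biprod (X (n - 1)) (Y n)) x y =
  bpair (biprod (X (n - 1 - 1)) (Y (n - 1)))
    (- (diff X (n - 1) ∘ x)) (f (n - 1) ∘ x + diff Y n ∘ y).
Proof.
apply: biproduct_ext; rewrite prl_bpair || rewrite prr_bpair; rewrite comp_assoc.
  by rewrite (prl_cone_diff f n) compNl -comp_assoc prl_bpair.
by rewrite (prr_cone_diff f n) compDl -!comp_assoc prl_bpair prr_bpair.
Qed.

Lemma prr_diff_cone X Y (f : chain_map X Y) n (W : A) (u : hom W (cone f n)) :
  prr (biprod (X (n - 1 - 1)) (Y (n - 1))) ∘ (diff (cone f) n ∘ u) =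
  f (n - 1) ∘ (prl (biprod (X (n - 1)) (Y n)) ∘ u) +
  diff Y n ∘ (prr (biprod (X (n - 1)) (Y n)) ∘ u).
Proof. by rewrite {1}(bpairE (b := biprod (X (n - 1)) (Y n)) u) cone_diffE prr_bpair. Qed.

(** It suffices to test on pairs, because the identity of the cone in degree [n] is the pair of its
    projections. All later computations with cones are done on such pairs. *)
Lemma cone_chain_map X Y (f : chain_map X Y) (Z : complex A)
    (h : forall n, hom (cone f n) (Z n)) :
  (forall n W (x : hom W (X (n - 1))) (y : hom W (Y n)),
     h (n - 1) ∘ bpair (biprod (X (n - 1 - 1)) (Y (n - 1)))
       (- (diff X (n - 1) ∘ x)) (f (n - 1) ∘ x + diff Y n ∘ y) =
     diff Z n ∘ (h n ∘ bpair (biprod (X (n - 1)) (Y n)) x y)) ->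
  forall n, h (n - 1) ∘ diff (cone f) n = diff Z n ∘ h n.
Proof.
move=> e n; set b := biprod (X (n - 1)) (Y n).
rewrite -[LHS](@comp_idr A) -[RHS](@comp_idr A) -!comp_assoc.
have -> : idm (cone f n) = bpair b (prl b) (prr b) by rewrite eq_bpair_id.
by rewrite cone_diffE e.
Qed.

Lemma cone_mapP X Y X' Y' (f : chain_map X Y) (f' : chain_map X' Y')
    (a : chain_map X X') (b : chain_map Y Y') :
  (forall n, f' n ∘ a n = b n ∘ f n) -> forall n,
  (bpair (biprod (X' (n - 1 - 1)) (Y' (n - 1))) (a (n - 1 - 1) ∘ prl _) (b (n - 1) ∘
    prr _)) ∘ diff (cone f) n =
  diff (cone f') n ∘ (bpair (biprod (X' (n - 1)) (Y' n)) (a (n - 1) ∘ prl _) (b n ∘ prr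
    _)).
Proof.
move=> e; apply: (@cone_chain_map _ _ f (cone f') (fun n => bpair (biprod (X' (n - 1))
  (Y' n)) (a (n - 1) ∘ prl _) (b n ∘ prr _))).
move=> n W x y; rewrite !bpair_comp -!comp_assoc !prl_bpair !prr_bpair cone_diffE.
congr bpair; first by rewrite compNr !comp_assoc chain_mapP.
by rewrite compDr !comp_assoc e chain_mapP.
Qed.

Definition cone_map X Y X' Y' (f : chain_map X Y) (f' : chain_map X' Y')
    (a : chain_map X X') (b : chain_map Y Y')
    (e : forall n, f' n ∘ a n = b n ∘ f n) : chain_map (cone f) (cone f') :=
  @ChainMap A (cone f) (cone f') _ (cone_mapP e).

Lemma cone_mapE X Y X' Y' (f : chain_map X Y) (f' : chain_map X' Y')
    (a : chain_map X X') (b : chain_map Y Y')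
    (e : forall n, f' n ∘ a n = b n ∘ f n) n W (x : hom W (X (n - 1)))
    (y : hom W (Y n)) :
  cone_map e n ∘ bpair (biprod (X (n - 1)) (Y n)) x y =
  bpair (biprod (X' (n - 1)) (Y' n)) (a (n - 1) ∘ x) (b n ∘ y).
Proof. by rewrite bpair_comp -!comp_assoc prl_bpair prr_bpair. Qed.

Lemma cone_elt X Y (f : chain_map X Y) n W (u : hom W (cone f n)) :
  exists (x : hom W (X (n - 1))) (y : hom W (Y n)),
    u = bpair (biprod (X (n - 1)) (Y n)) x y.
Proof. by exists (prl _ ∘ u), (prr _ ∘ u); apply: bpairE. Qed.

End ConeTheory.

Section QuasiIso.
Variable E : exact_category.
Hypothesis wic : weakly_idempotent_complete E.
Implicit Types (X Y Z : complex E) (n : int).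

(** A cycle of the cone is a cycle [x] of [X] with some [y] whose differential is minus the image of
    [x]. The cycle object is thus a pullback of the admissible epimorphism from [Y] onto its cycles.
    To bound [(x, y)], first bound [x] by [x'], then bound the corrected cycle [y + f x']; each of
    the two takes a cover. *)
Lemma acyclic_cone X Y (f : chain_map X Y) :
  acyclic X -> acyclic Y -> acyclic (cone f).
Proof.
move=> hX hY; apply/acyclicP => // n; split.
  have [Z [i hi]] := (acyclic_exact (n - 1) hX).1.
  have [ZY [j [q h]]] := hY.
  have [dq ses_q] := h (n - 1).
  have mj : monic (j (n - 1 - 1)).
    by have [_ s] := h (n - 1 - 1); exact: kernel_monic (ses_kernel s).
  have hj : is_kernel (diff Y (n - 1 - 1)) (j (n - 1 - 1)).
    by have [-> s] := h (n - 1 - 1); apply: kernel_monic_comp (ses_kernel s); have [_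
      s'] := h (n - 1 - 1 - 1); exact: kernel_monic (ses_kernel s').
  have [|t ht] := kernel_lift (u := f (n - 1 - 1) ∘ i) hj.
    by rewrite comp_assoc -chain_mapP -comp_assoc hi.1 comp0r.
  have [|P [a [b [[sq hP] _]]]] := @adm_epi_pullback E _ _ Z (q (n - 1)) (- t).
    by exists (ZY (n - 1)), (j (n - 1)).
  have mi := kernel_monic hi.
  exists P, (bpair (biprod (X (n - 1 - 1)) (Y (n - 1))) (i ∘ a) b).
  apply: is_kernelP.
  - rewrite cone_diffE comp_assoc hi.1 comp0l oppr0 comp_assoc -ht dq -!comp_assoc -sq.
    by rewrite compNl compNr subrr bpair0.
  - move=> W u v; rewrite !bpair_comp => /bpair_inj [e1 e2].
    have e3 : a ∘ u = a ∘ v by apply: mi; rewrite !comp_assoc.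
    have [|w [_ hw]] := hP W (a ∘ v) (b ∘ v); first by rewrite !comp_assoc sq.
    by rewrite -(hw u) // -(hw v).
  - move=> W u; have [x [y ->]] := cone_elt u; rewrite cone_diffE -(bpair0 _ W).
    move/bpair_inj => [/eqP]; rewrite oppr_eq0 => /eqP dx fxdy.
    have [x' hx'] := kernel_lift hi dx.
    have [|w [[aw bw] _]] := hP W x' y.
      apply: mj; rewrite compNl compNr comp_assoc ht -comp_assoc hx'.
      by rewrite comp_assoc -dq; apply: addr0_eq fxdy.
    by exists w; rewrite bpair_comp -comp_assoc aw bw hx'.
move=> W u; have [x [y ->]] := cone_elt u; rewrite cone_diffE -(bpair0 _ W).
move/bpair_inj => [/eqP]; rewrite oppr_eq0 => /eqP dx fxdy.
have [W' [e [x' [he dx']]]] := (acyclic_exact (n - 1) hX).2 W x dx.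
have [|W2 [e2 [y' [he2 dy']]]] := (acyclic_exact n hY).2 W' (y ∘ e + f (n - 1) ∘ x').
  rewrite compDr (comp_assoc _ (f _)) -chain_mapP -comp_assoc dx' !comp_assoc.
  by rewrite -(addr0_eq fxdy) compNl addNr.
exists W2, (e ∘ e2), (bpair (biprod (X (n - 1)) (Y n)) (- (x' ∘ e2)) y').
split; first exact: adm_epi_comp.
rewrite cone_diffE bpair_comp compNr opprK; congr bpair.
  by rewrite !comp_assoc dx'.
by rewrite compNr dy' compDl -!comp_assoc addrCA addNr addr0.
Qed.

End QuasiIso.

Lemma shift_diffE (A : preadditive) (X : complex A) (n : int) (W : A)
    (u : hom W (shift X n)) :
  diff (shift X) n ∘ u = - (diff X (n - 1) ∘ u).
Proof. exact: compNl. Qed.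

(** * Two-out-of-three for quasi-isomorphisms *)

Section TwoOfThree.
Variable E : exact_category.
Hypothesis wic : weakly_idempotent_complete E.
Hypothesis elem : weakly_omega_AdMon_elementary E.
Implicit Types (n : int).
Variables (X Y Z : complex E) (f : chain_map X Y) (g : chain_map Y Z)
  (h : chain_map X Z).
Hypothesis hE : forall n, h n = g n ∘ f n.

Local Notation B U V n := (biprod (U%function (n - 1)) (V%function n)).

Lemma cone_post_eq n : h n ∘ chain_map_id X n = g n ∘ f n.
Proof. by rewrite hE comp_idr. Qed.
Let u := cone_map cone_post_eq.

Lemma cone_pre_eq n : g n ∘ f n = chain_map_id Z n ∘ h n.
Proof. by rewrite hE comp_idl. Qed.
Let v := cone_map cone_pre_eq.

Let cong (U V : E) (b : biproduct U V) W (x x' : hom W U) (y y' : hom W V) :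
  x = x' -> y = y' -> bpair b x y = bpair b x' y'.
Proof. by move=> -> ->. Qed.

(** The map [u : cone f -> cone h] has an acyclic cone, of which [cone g] is a retract: [a] sends
    [(y, z)] to [((0, y), (0, z))] and [b] sends [((x', y'), (x, z))] to [(y' + f x, z)]. *)
Lemma qi_cancel_right : quasi_iso f -> quasi_iso h -> quasi_iso g.
Proof.
move=> hf hh; have hu : acyclic (cone u) by exact: acyclic_cone.
pose a n : hom (cone g n) (cone u n) :=
  bpair (B (cone f) (cone h) n)
    (bpair (B X Y (n - 1)) 0 (prl (B Y Z n))) (bpair (B X Z n) 0 (prr (B Y Z n))).
pose b n : hom (cone u n) (cone g n) :=
  bpair (B Y Z n)
   (prr (B X Y (n - 1)) ∘ prl (B (cone f) (cone h) n)
     + f (n - 1) ∘ (prl (B X Z n) ∘ prr (B (cone f) (cone h) n)))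
   (prr (B X Z n) ∘ prr (B (cone f) (cone h) n)).
have aE n W y z : a n ∘ bpair (B Y Z n) y z = 
  bpair (B (cone f) (cone h) n) (bpair (B X Y (n - 1)) 0 y) (bpair (B X Z n) 0 z) :>
    hom W _.
  by rewrite /a !bpair_comp prl_bpair prr_bpair !comp0l.
have bE n W x' y' x z : b n ∘ bpair (B (cone f) (cone h) n) (bpair (B X Y (n - 1)) x'
  y') (bpair (B X Z n) x z) = bpair (B Y Z n) (y' + f (n - 1) ∘ x) z :> hom W _.
  by rewrite /b bpair_comp compDl -!comp_assoc !(prl_bpair, prr_bpair).
have aP : forall n, a (n - 1) ∘ diff (cone g) n = diff (cone u) n ∘ a n.
  apply: cone_chain_map => n W y z; rewrite !aE !cone_diffE cone_mapE.
  rewrite !comp0r oppr0 add0r !add0r bpairN oppr0 bpairD.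
  by rewrite oppr0 ?add0r.
have bP : forall n, b (n - 1) ∘ diff (cone u) n = diff (cone g) n ∘ b n.
  apply: cone_chain_map => n W s t.
  have [x' [y' ->]] := cone_elt s; have [x [z ->]] := cone_elt t.
  rewrite !cone_diffE cone_mapE !bpairN !bpairD !bE cone_diffE; apply: cong.
    rewrite !(compDr (f _)) compNr comp_idl (compDr (diff Y _)) !comp_assoc chain_mapP.
    by rewrite opprD addrACA addNr add0r -opprD.
  by rewrite compDr hE comp_assoc addrA.
apply: (acyclic_retract wic elem (a := ChainMap aP) (b := ChainMap bP)) hu => n /=.
rewrite -[LHS](@comp_idr E) -(eq_bpair_id (b := B Y Z n) erefl erefl).
by rewrite -comp_assoc aE bE comp0r addr0.
Qed.

(** The map [v : cone h -> cone g] has an acyclic cone, of which the shift of [cone f] is a retract: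
    [a] sends [(x, y)] to [((x, g y), (- y, 0))] and [b] reads off [x] and [y] again. *)
Lemma qi_cancel_left : quasi_iso g -> quasi_iso h -> quasi_iso f.
Proof.
move=> hg hh; have hv : acyclic (cone v) by exact: acyclic_cone.
rewrite /quasi_iso -(acyclic_shift _ wic).
pose a n : hom (shift (cone f) n) (cone v n) :=
  bpair (B (cone h) (cone g) n)
    (bpair (B X Z (n - 1)) (prl (B X Y (n - 1))) (g (n - 1) ∘ prr (B X Y (n - 1))))
    (bpair (B Y Z n) (- prr (B X Y (n - 1))) 0).
pose b n : hom (cone v n) (shift (cone f) n) :=
  bpair (B X Y (n - 1))
   (prl (B X Z (n - 1)) ∘ prl (B (cone h) (cone g) n))
   (- (prl (B Y Z n) ∘ prr (B (cone h) (cone g) n))).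
have aE n W x y : a n ∘ bpair (B X Y (n - 1)) x y =
  bpair (B (cone h) (cone g) n) (bpair (B X Z (n - 1)) x (g (n - 1) ∘ y))
    (bpair (B Y Z n) (- y) 0) :> hom W _.
  rewrite /a !bpair_comp -!comp_assoc !(prl_bpair, prr_bpair) compNl comp0l.
  by rewrite prr_bpair.
have bE n W x z y z' : b n ∘ bpair (B (cone h) (cone g) n)
    (bpair (B X Z (n - 1)) x z) (bpair (B Y Z n) y z') =
  bpair (B X Y (n - 1)) x (- y) :> hom W _.
  by rewrite /b bpair_comp compNl -!comp_assoc !(prl_bpair, prr_bpair).
have aP : forall n, a (n - 1) ∘ diff (shift (cone f)) n = diff (cone v) n ∘ a n.
  move=> n; rewrite -[LHS](@comp_idr E) -[RHS](@comp_idr E) -!comp_assoc.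
  rewrite -(eq_bpair_id (b := B X Y (n - 1)) erefl erefl).
  move: (prl _) (prr _) => x y.
  rewrite shift_diffE cone_diffE bpairN !aE !cone_diffE cone_mapE.
  rewrite !(bpairN, bpairD); apply: cong; apply: cong.
  - by [].
  - by rewrite compNr compDr hE !comp_assoc chain_mapP.
  - by rewrite opprK compNr opprK.
  - by rewrite comp_idl compNr comp0r addr0 subrr.
have bP : forall n, b (n - 1) ∘ diff (cone v) n = diff (shift (cone f)) n ∘ b n.
  apply: cone_chain_map => n W s t.
  have [x [z ->]] := cone_elt s; have [y [z' ->]] := cone_elt t.
  rewrite !cone_diffE cone_mapE !bpairN !bpairD !bE shift_diffE cone_diffE bpairN;
    apply: cong.
    by [].
  by rewrite compNr.
apply: (acyclic_retract wic elem (a := ChainMap aP) (b := ChainMap bP)) hv => n.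
rewrite -[LHS](@comp_idr E) -(eq_bpair_id (b := B X Y (n - 1)) erefl erefl).
by rewrite -comp_assoc aE bE opprK.
Qed.

(** This is the connecting map of the triangle of cones, sending [(y, z)] to [(0, y)]. *)
Lemma cone_to_shiftP n :
  bpair (B X Y (n - 1 - 1)) 0 (prl (B Y Z (n - 1))) ∘ diff (cone g) n =
  diff (shift (cone f)) n ∘ bpair (B X Y (n - 1)) 0 (prl (B Y Z n)).
Proof.
apply: (@cone_chain_map _ _ _ g (shift (cone f)) (fun n => bpair (B X Y (n - 1)) 0 (prl
  (B Y Z n)))).
move=> {}n W y z; rewrite shift_diffE !bpair_comp !prl_bpair !comp0l cone_diffE bpairN.
by rewrite !comp0r !oppr0 add0r.
Qed.

(** The cone of the connecting map [w] is acyclic and has the shift of [cone h] as a retract: [a]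
    sends [(x, z)] to [((f x, z), (x, 0))] and [b] sends [((y, z), (x, y'))] to [(x, z + g y')]. *)
Lemma qi_comp : quasi_iso f -> quasi_iso g -> quasi_iso h.
Proof.
move=> hf hg; pose w := @ChainMap E (cone g) (shift (cone f)) _ cone_to_shiftP.
have hw : acyclic (cone w) by apply: acyclic_cone => //; apply/acyclic_shift.
rewrite /quasi_iso -(acyclic_shift _ wic).
pose a n : hom (shift (cone h) n) (cone w n) :=
  bpair (B (cone g) (shift (cone f)) n)
    (bpair (B Y Z (n - 1)) (f (n - 1 - 1) ∘ prl (B X Z (n - 1))) (prr (B X Z (n - 1))))
    (bpair (B X Y (n - 1)) (prl (B X Z (n - 1))) 0).
pose b n : hom (cone w n) (shift (cone h) n) :=
  bpair (B X Z (n - 1))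
   (prl (B X Y (n - 1)) ∘ prr (B (cone g) (shift (cone f)) n))
   (prr (B Y Z (n - 1)) ∘ prl (B (cone g) (shift (cone f)) n) +
    g (n - 1) ∘ (prr (B X Y (n - 1)) ∘ prr (B (cone g) (shift (cone f)) n))).
have wE n W y z : w n ∘ bpair (B Y Z n) y z = bpair (B X Y (n - 1)) 0 y :> hom W _.
  by rewrite bpair_comp prl_bpair comp0l.
have aE n W x z : a n ∘ bpair (B X Z (n - 1)) x z =
  bpair (B (cone g) (shift (cone f)) n) (bpair (B Y Z (n - 1)) (f (n - 1 - 1) ∘ x) z)
    (bpair (B X Y (n - 1)) x 0) :> hom W _.
  by rewrite /a !bpair_comp -!comp_assoc !(prl_bpair, prr_bpair) comp0l.
have bE n W y z x y' : b n ∘ bpair (B (cone g) (shift (cone f)) n)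
    (bpair (B Y Z (n - 1)) y z) (bpair (B X Y (n - 1)) x y') =
  bpair (B X Z (n - 1)) x (z + g (n - 1) ∘ y') :> hom W _.
  by rewrite /b bpair_comp compDl -!comp_assoc !(prl_bpair, prr_bpair).
have aP : forall n, a (n - 1) ∘ diff (shift (cone h)) n = diff (cone w) n ∘ a n.
  move=> n; rewrite -[LHS](@comp_idr E) -[RHS](@comp_idr E) -!comp_assoc.
  rewrite -(eq_bpair_id (b := B X Z (n - 1)) erefl erefl).
  move: (prl _) (prr _) => x z.
  rewrite shift_diffE cone_diffE bpairN !aE !cone_diffE wE shift_diffE.
  rewrite cone_diffE !(bpairN, bpairD); apply: cong; apply: cong.
  - by rewrite !opprK !comp_assoc chain_mapP.
  - by rewrite hE -comp_assoc.
  - by rewrite sub0r.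
  - by rewrite comp0r addr0 subrr.
have bP : forall n, b (n - 1) ∘ diff (cone w) n = diff (shift (cone h)) n ∘ b n.
  apply: (@cone_chain_map _ _ _ w (shift (cone h)) b) => n W s t.
  have [y [z ->]] := cone_elt s; have [x [y' ->]] := @cone_elt E _ _ f (n - 1) W t.
  rewrite !cone_diffE wE shift_diffE !bpairN cone_diffE !bpairN !bpairD !bE.
  rewrite shift_diffE cone_diffE bpairN; apply: cong.
    by rewrite sub0r.
  rewrite !(compDr, compNr) !comp_assoc chain_mapP -hE.
  by rewrite (opprD (_ ∘ y)) addrACA addNr add0r -opprD addrCA.
pose a_ := @ChainMap E (shift (cone h)) (cone w) a aP; pose b_ := @ChainMap E (cone w)
  (shift (cone h)) b bP.
apply: (acyclic_retract wic elem (a := a_) (b := b_)) hw => n.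
rewrite -[LHS](@comp_idr E) -(eq_bpair_id (b := B X Z (n - 1)) erefl erefl).
by rewrite -comp_assoc aE bE comp0r addr0.
Qed.

End TwoOfThree.

(** * Subsequences and degreewise colimits *)

(** A cycle [(x, y)] of the cone is determined by [y], since [x] must be [- g (d y)]. Hence the
    cycles form a copy of [Y], and each is the boundary of [(g y, 0)]. *)
Lemma qi_iso (E : exact_category) (X Y : Ch E) (f : hom X Y) :
  weakly_idempotent_complete E -> is_iso f -> quasi_iso f.
Proof.
move=> wic [g [gf fg]]; apply/acyclicP => // n.
have gfn m : at_deg g m ∘ at_deg f m = idm (X m).
  by have := congr1 (fun h : chain_map X X => h m) gf.
have fgn m : at_deg f m ∘ at_deg g m = idm (Y m).
  by have := congr1 (fun h : chain_map Y Y => h m) fg.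
split.
  exists (Y (n - 1)), (bpair (biprod (X (n - 1 - 1)) (Y (n - 1)))
    (- (at_deg g (n - 1 - 1) ∘ diff Y (n - 1))) (idm _)).
  apply: is_kernelP.
  - rewrite cone_diffE !compNr comp_idr !comp_assoc -chain_mapP -comp_assoc.
    by rewrite diff_diff comp0r !oppr0 fgn comp_idl addNr bpair0.
  - by move=> W u v; rewrite !bpair_comp !comp_idl => /bpair_inj [].
  move=> W u; have [x [y ->]] := cone_elt u; rewrite cone_diffE -(bpair0 _ W).
  move/bpair_inj => [_ e]; exists y; rewrite bpair_comp comp_idl; congr bpair.
  by rewrite compNl -comp_assoc -(addr0_eq e) compNr opprK comp_assoc gfn comp_idl.
move=> W u; have [x [y ->]] := cone_elt u; rewrite cone_diffE -(bpair0 _ W).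
move/bpair_inj => [_ e].
exists W, (idm W), (bpair (biprod (X (n - 1)) (Y n)) (at_deg g (n - 1) ∘ y) 0).
split; first exact: adm_epi_id.
rewrite cone_diffE comp0r addr0 comp_idr !comp_assoc fgn comp_idl -chain_mapP.
by rewrite -comp_assoc -(addr0_eq e) compNr opprK comp_assoc gfn comp_idl.
Qed.

Section Subsequence.
Variables (C : category) (X : omega_diagram C).

Fixpoint steps (n d : nat) : hom (X n) (X (d + n)%N) :=
  match d with 0 => idm _ | d'.+1 => dmap X (d' + n)%N ∘ steps n d' end.

(** A relation instead of a function, so that the cast along [d + n = m] is met only in the first
    few lemmas; afterwards [transition_ind] and uniqueness suffice. *)
Definition transition (n m : nat) (t : hom (X n) (X m)) : Prop :=
  exists (d : nat) (e : (d + n)%N = m),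
    t = ecast x (hom (X n) (X x)) e (steps n d).

Lemma transition_unique n m (t t' : hom (X n) (X m)) :
  transition t -> transition t' -> t = t'.
Proof.
move=> [d [e ->]] [d' [e' ->]].
have dd : d = d' by apply: (@addIn n); rewrite e e'.
by case: _ / dd e' => e'; rewrite (eq_irrelevance e e').
Qed.

Lemma transition_id n : transition (idm (X n)).
Proof. by exists 0%N, erefl. Qed.

Lemma transitionS n m (t : hom (X n) (X m)) :
  transition t -> transition (dmap X m ∘ t).
Proof. by move=> [d [e ->]]; case: _ / e; exists d.+1, erefl. Qed.

Lemma transition_ind (P : forall n m, hom (X n) (X m) -> Prop) :
  (forall n, P n n (idm (X n))) ->
  (forall n m (t : hom (X n) (X m)), P n m t -> P n m.+1 (dmap X m ∘ t)) ->
  forall n m (t : hom (X n) (X m)), transition t -> P n m t.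
Proof.
move=> P0 PS n m t [d [e ->]]; case: _ / e => /=.
by elim: d => [|d IH] /=; [exact: P0|exact: PS].
Qed.

Lemma transition_comp n m p (s : hom (X m) (X p)) (t : hom (X n) (X m)) :
  transition s -> transition t -> transition (s ∘ t).
Proof.
move=> hs; move: n t; elim/transition_ind: hs => {m p s}.
  by move=> m n t; rewrite comp_idl.
move=> m p s IH n t ht; rewrite -comp_assoc; apply: transitionS; exact: IH.
Qed.

Lemma transition_exists n m : (n <= m)%N -> exists t : hom (X n) (X m), transition t.
Proof.
move=> h; exists (ecast x (hom (X n) (X x)) (subnK h) (steps n (m - n))).
by exists (m - n)%N, (subnK h).
Qed.

Lemma transition_cocone n m (t : hom (X n) (X m)) W (u : forall n, hom (X n) W) :
  is_cocone u -> transition t -> u m ∘ t = u n.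
Proof.
move=> cu ht; elim/transition_ind: ht => {n m t} [n|n m t IH].
  by rewrite comp_idr.
by rewrite comp_assoc cu.
Qed.

End Subsequence.

Lemma transition_subsequence (C : category) (X : omega_diagram C) (s : nat -> nat)
    (t : forall i, hom (X (s i)) (X (s i.+1))) :
  (forall i, transition (t i)) ->
  forall i j (r : hom (OmegaDiagram t i) (OmegaDiagram t j)),
  transition r -> @transition C X (s i) (s j) r.
Proof.
move=> ht i j r hr; elim/transition_ind: hr => {i j r} [i|i j r IH].
  exact: transition_id.
by apply: (@transition_comp C X (s i) (s j) (s j.+1) (t j) r).
Qed.

(** A cocone on the subsequence extends to [X n] through any transition to some [X (s i)]; two such
    extensions agree because they can be compared at [maxn i j]. The sequence [s] may repeat values,
    as the coordinates of the zigzag below do. *)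
Lemma cofinal_colimit (C : category) (X : omega_diagram C) (s : nat -> nat)
    (t : forall i, hom (X (s i)) (X (s i.+1))) L (c : forall n, hom (X n) L) :
  (forall n, exists i, (n <= s i)%N) -> (forall i, transition (t i)) ->
  is_colimit c ->
  is_colimit (X := OmegaDiagram t) (fun i => c (s i)).
Proof.
move=> /dep_choice [k hk] ht hc.
have /dep_choice [r hr] : forall n, exists r : hom (X n) (X (s (k n))), transition r.
  by move=> n; apply: transition_exists.
apply: colimitP.
- by move=> i; exact: (transition_cocone hc.1 (ht i)).
- move=> W u cu.
  have u_eq n i j (a : hom (X n) (X (s i))) (b : hom (X n) (X (s j))) :
      transition a -> transition b -> u i ∘ a = u j ∘ b.
    move=> ta tb.
    have [p hp] := @transition_exists C (OmegaDiagram t) i (maxn i j) (leq_maxl i j).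
    have [q hq] := @transition_exists C (OmegaDiagram t) j (maxn i j) (leq_maxr i j).
    rewrite -(transition_cocone cu hp) -(transition_cocone cu hq) -!comp_assoc.
    congr (_ ∘ _); apply: (@transition_unique C X n (s (maxn i j))).
      apply: (@transition_comp C X n (s i) (s (maxn i j)) p a) => //.
      exact: transition_subsequence hp.
    apply: (@transition_comp C X n (s j) (s (maxn i j)) q b) => //.
    exact: transition_subsequence hq.
  have [|w hw] := colimit_lift hc (u := fun n => u (k n) ∘ r n).
    move=> n; rewrite -comp_assoc; apply: u_eq => //.
    apply: transition_comp; first exact: hr.
    by rewrite -(comp_idr (dmap X n)); apply: transitionS; exact: transition_id.
  exists w => i; rewrite hw -[RHS]comp_idr; apply: u_eq; first exact: hr.
  exact: transition_id.
- move=> W u v h; apply: (colimit_ext hc) => n.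
  by rewrite -(transition_cocone hc.1 (hr n)) !comp_assoc h.
Qed.

Definition map_diagram (C C' : category) (G : functor C C') (X : omega_diagram C) :
  omega_diagram C' := OmegaDiagram (fun n => fmap G (dmap X n)).

Lemma transition_map (C C' : category) (G : functor C C') (X : omega_diagram C)
    n m (t : hom (X n) (X m)) :
  transition t -> @transition C' (map_diagram G X) n m (fmap G t).
Proof.
move=> ht; elim/transition_ind: ht => {n m t} [n|n m t IH].
  by rewrite fmap_id; exact: transition_id.
by rewrite fmap_comp; apply: (@transitionS C' (map_diagram G X) n m _ IH).
Qed.

Section DegreewiseColimits.
Variable A : preadditive.
Implicit Types K : omega_diagram (Ch A).

Definition deg_diagram K (k : int) : omega_diagram A :=
  @OmegaDiagram A (fun n => deg (K n) k) (fun n => at_deg (dmap K n) k).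

(** The form in which colimits of complexes are handled: exactness of sequential colimits and
    [fmap_split_colimit] concern objects and are applied in one degree at a time. *)
Definition degreewise_colimit K (L : Ch A) (c : forall n, hom (K n) L) : Prop :=
  forall k, is_colimit (X := deg_diagram K k) (fun n => at_deg (c n) k).

End DegreewiseColimits.

Section DegreewiseColimitsTheory.
Variable A : preadditive.
Implicit Types K : omega_diagram (Ch A).

Lemma deg_cocone K (W : Ch A) (u : forall n, hom (K n) W) k :
  is_cocone u -> is_cocone (X := deg_diagram K k) (fun n => at_deg (u n) k).
Proof. by move=> cu n; rewrite -(cu n). Qed.

Lemma degreewise_colimitP K (L : Ch A) (c : forall n, hom (K n) L) :
  degreewise_colimit c -> is_colimit c.
Proof.
move=> hc; apply: colimitP.
- by move=> n; apply: chain_map_ext => k; have [cc _] := hc k; exact: (cc n).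
- move=> W u cu.
  have /dep_choice [w hw] : forall k, exists w : hom (deg L k) (deg W k),
      forall n, w ∘ at_deg (c n) k = at_deg (u n) k.
    by move=> k; exact: (colimit_lift (hc k) (deg_cocone k cu)).
  have wP k : w (k - 1) ∘ diff L k = diff W k ∘ w k.
    apply: (colimit_ext (hc k)) => n; rewrite -!comp_assoc hw -chain_mapP.
    by rewrite -(chain_mapP (u n)) comp_assoc hw.
  exists (ChainMap wP) => n; apply: chain_map_ext => k; exact: hw.
- move=> W u v e; apply: chain_map_ext => k; apply: (colimit_ext (hc k)) => n.
  by have := congr1 (fun h : chain_map (K n) W => h k) (e n).
Qed.

Lemma degreewise_colimit_exists K :
  (forall k, exists (L : A) (c : forall n, hom (deg_diagram K k n) L), is_colimit c) ->
  exists (L : Ch A) (c : forall n, hom (K n) L), degreewise_colimit c.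
Proof.
move=> /dep_choice [L] /dep_choice [c hc].
have /dep_choice [d hd] : forall k, exists d : hom (L k) (L (k - 1)),
    forall n, d ∘ c k n = c (k - 1) n ∘ diff (K n) k.
  move=> k; apply: (colimit_lift (hc k)) => n /=.
  rewrite -comp_assoc -chain_mapP comp_assoc; congr (_ ∘ _).
  by have [cc _] := hc (k - 1); exact: (cc n).
have dd k : d (k - 1) ∘ d k = 0.
  apply: (colimit_ext (hc k)) => n.
  by rewrite -comp_assoc hd comp_assoc hd -comp_assoc diff_diff comp0r comp0l.
pose LC : complex A := Complex dd.
exists LC, (fun n => @ChainMap A (K n) LC (fun k => c k n) (fun k => esym (hd k n))).
by move=> k; exact: hc.
Qed.

Lemma transition_deg K n m (t : hom (K n) (K m)) k :
  transition t -> @transition A (deg_diagram K k) n m (at_deg t k).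
Proof.
move=> ht; elim/transition_ind: ht => {n m t} [n|n m t IH].
  exact: transition_id.
exact: transitionS IH.
Qed.

End DegreewiseColimitsTheory.

(** * Sequential colimits of acyclic complexes and of quasi-isomorphisms *)

Section AcyclicColimit.
Variable E : exact_category.
Hypothesis wic : weakly_idempotent_complete E.
Hypothesis elem : weakly_omega_AdMon_elementary E.

(** The bound depends on the degree because the maps between truncations are admissible
    monomorphisms only in degrees above [- n]. *)
Definition eventually_adm_mono (K : omega_diagram (Ch E)) : Prop :=
  forall k, exists N, forall n, (N <= n)%N -> adm_mono (at_deg (dmap K n) k).

Lemma transition_adm_mono (X : omega_diagram E) N n m (t : hom (X n) (X m)) :
  (forall n, (N <= n)%N -> adm_mono (dmap X n)) -> (N <= n)%N ->
  transition t -> adm_mono t.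
Proof.
move=> h hn ht; suff : (N <= m)%N /\ adm_mono t by case.
elim/transition_ind: ht hn => {n m t} [n|n m t IH] hn.
  by split=> //; exact: adm_mono_id.
have [hm tm] := IH hn; split; first exact: leqW.
by apply: adm_mono_comp tm; exact: h.
Qed.

Lemma eventually_adm_mono_colimit (X : omega_diagram E) N :
  (forall n, (N <= n)%N -> adm_mono (dmap X n)) ->
  exists (L : E) (c : forall n, hom (X n) L), is_colimit c.
Proof.
move=> h; pose s i := (N + i)%N.
have /dep_choice [t ht] : forall i, exists t : hom (X (s i)) (X (s i.+1)), transition t.
  by move=> i; apply: transition_exists; rewrite /s leq_add2l.
have [L [c hc]] := elem.1 (OmegaDiagram t) (fun i =>
  transition_adm_mono h (leq_addr i N) (ht i)).
have sn n : (n <= s n)%N by exact: leq_addl.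
have /dep_choice [r hr] : forall n, exists r : hom (X n) (X (s n)), transition r.
  by move=> n; exact: transition_exists.
exists L, (fun n => c n ∘ r n); apply: colimitP.
- move=> n; rewrite -(hc.1 n) -!comp_assoc; congr (_ ∘ _).
  apply: transition_unique; apply: transition_comp => //.
  by rewrite -(comp_idr (dmap X n)); apply: transitionS; exact: transition_id.
- move=> W u cu; have [|w hw] := colimit_lift (u := fun i => u (s i)) hc.
    by move=> i; exact: (transition_cocone cu (ht i)).
  by exists w => n; rewrite comp_assoc hw; exact: transition_cocone.
- move=> W u v e; apply: (colimit_ext hc) => i.
  have [r' hr'] := @transition_exists _ (OmegaDiagram t) i (s i) (sn i).
  rewrite -(transition_cocone hc.1 hr') -(_ : r (s i) = r') ?e //.
  by apply: (transition_unique (hr (s i))); exact: transition_subsequence hr'.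
Qed.

(** On a cofinal subsequence of acyclic terms, the cycle objects form sequences of admissible
    monomorphisms in the relevant degrees. The colimits of the short exact sequences of cycles are
    short exact and factor the differential of [L]. *)
Lemma acyclic_colimit (K : omega_diagram (Ch E)) (L : Ch E)
    (c : forall n, hom (K n) L) :
  degreewise_colimit c -> eventually_adm_mono K ->
  (forall n, exists2 m, (n <= m)%N & acyclic (K m)) -> acyclic L.
Proof.
move=> hc hK hac; apply: acyclic_factorization => n.
(* Factoring the differential in degree [n] and describing the kernel of the next one takes the
   short exact sequences in degrees [n], [n - 1] and [n - 2], whose last terms are cycles down to
   degree [n - 3]. One [N] serves all four degrees. *)
have [N hN] : exists N, forall k, k \in [:: n; n - 1; n - 1 - 1; n - 1 - 1 - 1] ->
    forall m, (N <= m)%N -> adm_mono (at_deg (dmap K m) k).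
  have [f hf] := dep_choice hK.
  exists (\max_(k <- [:: n; n - 1; n - 1 - 1; n - 1 - 1 - 1]%R) f k)%N => k hk m hm.
  by apply: hf; apply: leq_trans hm; exact: leq_bigmax_seq.
have /dep_choice [j hj] : forall n, exists m, (n <= m)%N /\ acyclic (K m).
  by move=> i; have [m] := hac i; exists m.
(* A strictly increasing choice of indices, all at least [N], at which the complex is acyclic. *)
pose s := fix s i := match i with 0 => j N | i'.+1 => j (s i').+1 end.
have s_ac i : acyclic (K (s i)) by case: i => [|i]; exact: (hj _).2.
have ss i : (s i < s i.+1)%N by exact: (hj _).1.
have s_cofinal m : exists i, (m <= s i)%N.
  by exists m; elim: m => // m IH; exact: leq_ltn_trans (ss m).
have Ns i : (N <= s i)%N.
  by elim: i => [|i IH]; [exact: (hj _).1|exact: leq_trans IH (ltnW (ss i))].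
have /dep_choice [t ht] : forall i, exists t : hom (K (s i)) (K (s i.+1)), transition t.
  by move=> i; apply: transition_exists; exact: ltnW.
pose G k := forall m, (N <= m)%N -> adm_mono (at_deg (dmap K m) k).
have tk i k : @transition E (deg_diagram K k) _ _ (at_deg (t i) k).
  exact: transition_deg.
have t_adm i k : G k -> adm_mono (at_deg (t i) k).
  move=> Gk; exact: (@transition_adm_mono (deg_diagram K k) N _ _ (at_deg (t i) k) Gk
    (Ns i) (tk i k)).
pose KD k := @OmegaDiagram E (fun i => deg (K (s i)) k) (fun i => at_deg (t i) k).
have c_colim k : is_colimit (X := KD k)
    (fun i => at_deg (c (s i)) k).
  exact: (@cofinal_colimit E (deg_diagram K k) s (fun i => at_deg (t i) k) _ _
    s_cofinal (fun i => tk i k) (hc k)).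
move/dep_choice: s_ac => [Z /dep_choice [ii /dep_choice [pp hZ]]].
have mii i k : monic (ii i k) by have [_ h] := hZ i k; exact: kernel_monic (ses_kernel h).
have z_ex i k : exists z : hom (Z i k) (Z i.+1 k),
    ii i.+1 k ∘ z = at_deg (t i) k ∘ ii i k.
  have [d1 h1] := hZ i k; have [d2 h2] := hZ i.+1 k.
  apply: (kernel_lift (ses_kernel h2)); apply: mii.
  rewrite comp0r !comp_assoc -d2 -chain_mapP -comp_assoc d1 -comp_assoc.
  by rewrite (ses_kernel h1).1 !comp0r.
have /dep_choice [z hz] : forall i, exists z : forall k, hom (Z i k) (Z i.+1 k),
    forall k, ii i.+1 k ∘ z k = at_deg (t i) k ∘ ii i k.
  by move=> i; exact: (dep_choice (z_ex i)).
have pz i k : pp i.+1 k ∘ at_deg (t i) k = z i (k - 1) ∘ pp i k.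
  apply: mii; have [d1 _] := hZ i k; have [d2 _] := hZ i.+1 k.
  by rewrite !comp_assoc -d2 hz -comp_assoc -d1 chain_mapP.
(* The composite of [z] with the inclusion of cycles is an admissible monomorphism, and weak
   idempotent completeness allows that inclusion to be cancelled. *)
have z_adm i k : G k -> adm_mono (z i k).
  move=> Gk; apply: (@adm_mono_cancel E _ _ _ (z i k) (ii i.+1 k) wic).
  rewrite hz; apply: adm_mono_comp; first exact: t_adm.
  by have [_ h] := hZ i k; exists (Z i (k - 1)), (pp i k).
pose ZD k := @OmegaDiagram E (fun i => Z i k) (fun i => z i k).
have Zcolim k : G k -> exists (LZ : E) (cz : forall i, hom (ZD k i) LZ), is_colimit cz.
  by move=> Gk; apply: elem.1 => i; exact: z_adm.
have step k (LZ LZ' : E) (cz : forall i, hom (ZD k i) LZ)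
    (cz' : forall i, hom (ZD (k - 1) i) LZ') : G k -> G (k - 1) ->
    is_colimit cz -> is_colimit cz' ->
    exists (u : hom LZ (deg L k)) (v : hom (deg L k) LZ'),
      [/\ ses u v, forall i, u ∘ cz i = at_deg (c (s i)) k ∘ ii i k
        & forall i, v ∘ at_deg (c (s i)) k = cz' i ∘ pp i k].
  move=> Gk Gk' hcz hcz'.
  have [|u hu] := colimit_lift (u := fun i => at_deg (c (s i)) k ∘ ii i k) hcz.
    by move=> i; rewrite -comp_assoc hz comp_assoc -((c_colim k).1 i).
  have [|v hv] := colimit_lift (u := fun i => cz' i ∘ pp i k) (c_colim k).
    by move=> i; rewrite -comp_assoc pz comp_assoc -(hcz'.1 i).
  exists u, v; split=> //.
  apply: (elem.2 (ZD k) (KD k) (ZD (k - 1)) (fun i => ii i k) (fun i => pp i k)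
    LZ (deg L k) LZ' cz (fun i => at_deg (c (s i)) k) cz' u v).
  - by move=> i; exact: z_adm.
  - by move=> i; exact: t_adm.
  - by move=> i; exact: z_adm.
  - by move=> i; exact: hz.
  - by move=> i; exact: pz.
  - by move=> i; have [] := hZ i k.
  - exact: hcz.
  - exact: c_colim.
  - exact: hcz'.
  - exact: hu.
  - exact: hv.
have Gn : G n by apply: hN; rewrite !inE eqxx ?orbT.
have Gn1 : G (n - 1) by apply: hN; rewrite !inE eqxx ?orbT.
have Gn2 : G (n - 1 - 1) by apply: hN; rewrite !inE eqxx ?orbT.
have Gn3 : G (n - 1 - 1 - 1) by apply: hN; rewrite !inE eqxx ?orbT.
have [L0 [c0 hc0]] := Zcolim _ Gn.
have [L1 [c1 hc1]] := Zcolim _ Gn1.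
have [L2 [c2 hc2]] := Zcolim _ Gn2.
have [L3 [c3 hc3]] := Zcolim _ Gn3.
have [u0 [v0 [ses0 _ hv0]]] := step _ _ _ _ _ Gn Gn1 hc0 hc1.
have [u1 [v1 [ses1 hu1 hv1]]] := step _ _ _ _ _ Gn1 Gn2 hc1 hc2.
have [u2 [v2 [ses2 hu2 _]]] := step _ _ _ _ _ Gn2 Gn3 hc2 hc3.
have dE k LZ (cz : forall i, hom (ZD (k - 1) i) LZ) (u : hom LZ (deg L (k - 1)))
    (v : hom (deg L k) LZ) :
    (forall i, u ∘ cz i = at_deg (c (s i)) (k - 1) ∘ ii i (k - 1)) ->
    (forall i, v ∘ at_deg (c (s i)) k = cz i ∘ pp i k) -> diff L k = u ∘ v.
  move=> hu hv; apply: (colimit_ext (c_colim k)) => i.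
  rewrite -comp_assoc hv comp_assoc hu -comp_assoc -(hZ i k).1.
  by rewrite -chain_mapP.
exists L1, u1, v0; split.
- rewrite (dE (n - 1) _ _ u2 v1 hu2 hv1).
  by apply: kernel_monic_comp; [exact: kernel_monic (ses_kernel ses2)|exact: ses_kernel].
- by exists L0, u0.
- exact: dE hu1 hv0.
Qed.

(** The cones of the [f n] form a sequence whose degreewise colimit is the cone of [g], since
    biproducts commute with colimits. Acyclicity for cofinally many [n] is then enough. *)
Lemma qi_colimit (X Y : omega_diagram (Ch E)) (LX LY : Ch E)
    (cX : forall n, hom (X n) LX) (cY : forall n, hom (Y n) LY)
    (f : forall n, hom (X n) (Y n)) (g : hom LX LY) :
  (forall n, f n.+1 ∘ dmap X n = dmap Y n ∘ f n) ->
  (forall n, g ∘ cX n = cY n ∘ f n) ->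
  degreewise_colimit cX -> degreewise_colimit cY ->
  eventually_adm_mono X -> eventually_adm_mono Y ->
  (forall n, exists2 m, (n <= m)%N & quasi_iso (f m)) -> quasi_iso g.
Proof.
move=> hf hg hX hY mX mY hqi.
have hf' n k : at_deg (f n.+1) k ∘ at_deg (dmap X n) k = at_deg (dmap Y n) k ∘ at_deg
  (f n) k.
  by have := congr1 (fun h : chain_map _ _ => h k) (hf n).
have hg' n k : at_deg g k ∘ at_deg (cX n) k = at_deg (cY n) k ∘ at_deg (f n) k.
  by have := congr1 (fun h : chain_map _ _ => h k) (hg n).
pose K := @OmegaDiagram (Ch E) (fun n => cone (f n)) (fun n => cone_map (hf' n)).
pose c n : hom (K n) (cone g : Ch E) := cone_map (hg' n).
apply: (@acyclic_colimit K (cone g) c) => //; last first.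
  move=> k; have [N1 h1] := mX (k - 1); have [N2 h2] := mY k.
  exists (maxn N1 N2) => n; rewrite geq_max => /andP [n1 n2].
  apply: (@biproduct_map_adm_mono E _ _ _ _ (biprod (deg (X n) (k - 1)) (deg (Y n) k))
    (biprod (deg (X n.+1) (k - 1)) (deg (Y n.+1) k)) (at_deg (dmap X n) (k - 1))
      (at_deg (dmap Y n) k)
    (at_deg (dmap K n) k) _ _ (h1 n n1) (h2 n n2)).
    exact: prl_bpair.
  exact: prr_bpair.
move=> k; pose B n := biprod (deg (X n) (k - 1)) (deg (Y n) k).
pose BL := biprod (deg LX (k - 1)) (deg LY k).
have Kl n : at_deg (dmap K n) k ∘ binl (B n) = binl (B n.+1) ∘ at_deg (dmap X n) (k - 1).
  rewrite bpair_comp -!comp_assoc prl_binl prr_binl comp0r comp_idr.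
  by rewrite /bpair comp0r addr0.
have Kr n : at_deg (dmap K n) k ∘ binr (B n) = binr (B n.+1) ∘ at_deg (dmap Y n) k.
  rewrite bpair_comp -!comp_assoc prl_binr prr_binr comp0r comp_idr.
  by rewrite /bpair comp0r add0r.
have cl n : at_deg (c n) k ∘ binl (B n) = binl BL ∘ at_deg (cX n) (k - 1).
  rewrite bpair_comp -!comp_assoc prl_binl prr_binl comp0r comp_idr.
  by rewrite /bpair comp0r addr0.
have cr n : at_deg (c n) k ∘ binr (B n) = binr BL ∘ at_deg (cY n) k.
  rewrite bpair_comp -!comp_assoc prl_binr prr_binr comp0r comp_idr.
  by rewrite /bpair comp0r add0r.
apply: colimitP.
- move=> n; apply: (biproduct_coext (b := B n)).
    rewrite -comp_assoc [in LHS]Kl comp_assoc cl -comp_assoc cl; congr (_ ∘ _).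
    exact: ((hX (k - 1)).1 n).
  rewrite -comp_assoc [in LHS]Kr comp_assoc cr -comp_assoc cr; congr (_ ∘ _).
  exact: ((hY k).1 n).
- move=> W u cu.
  have [|wl hl] := colimit_lift (u := fun n => u n ∘ binl (B n)) (hX (k - 1)).
    by move=> n /=; rewrite -comp_assoc -Kl comp_assoc; congr (_ ∘ _); exact: cu.
  have [|wr hr] := colimit_lift (u := fun n => u n ∘ binr (B n)) (hY k).
    by move=> n /=; rewrite -comp_assoc -Kr comp_assoc; congr (_ ∘ _); exact: cu.
  exists (wl ∘ prl BL + wr ∘ prr BL) => n.
  apply: (biproduct_coext (b := B n)); rewrite -comp_assoc ?cl ?cr compDl -!comp_assoc.
    by rewrite prlK prr_binl0 comp0r addr0 hl.
  by rewrite prrK prl_binr0 comp0r add0r hr.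
- move=> W u v e; apply: (biproduct_coext (b := BL)).
    apply: (colimit_ext (hX (k - 1))) => n.
    by rewrite -!comp_assoc -cl !comp_assoc e.
  apply: (colimit_ext (hY k)) => n.
  by rewrite -!comp_assoc -cr !comp_assoc e.
Qed.

End AcyclicColimit.

(** * Resolutions of sequences of complexes *)

Lemma is_zeroP (A : preadditive) (Z : A) : is_zero Z <-> idm Z = 0.
Proof.
split=> [[h _]|z0].
  by have [f [_ u]] := h Z; rewrite -(u (idm Z) I) -(u 0 I).
split=> X; exists 0; split=> // f _.
  by rewrite -(comp_idr f) z0 comp0r.
by rewrite -(comp_idl f) z0 comp0l.
Qed.

Lemma is_zero_biproduct (A : preadditive) (X Y : A) (b : biproduct X Y) :
  is_zero X -> is_zero Y -> is_zero b.
Proof.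
move=> /is_zeroP X0 /is_zeroP Y0; apply/is_zeroP.
rewrite -(biproduct_id b) -(comp_idr (binl b)) X0 -(comp_idr (binr b)) Y0.
by rewrite !comp0r !comp0l addr0.
Qed.

Lemma concentrated_cone (A : additive_category) (X Y : complex A)
    (f : chain_map X Y) (n : int) :
  concentrated_ge n X -> concentrated_ge n Y -> concentrated_ge n (cone f).
Proof.
move=> hX hY k kn; apply: is_zero_biproduct; last exact: hY.
by apply: hX; apply: le_lt_trans kn; rewrite gerBl.
Qed.

Lemma concentrated_le (A : preadditive) (X : complex A) (m n : int) :
  m <= n -> concentrated_ge n X -> concentrated_ge m X.
Proof. by move=> mn h k km; apply: h; exact: lt_le_trans mn. Qed.

Lemma bounded_below2 (A : preadditive) (X Y : complex A) :
  bounded_below X -> bounded_below Y ->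
  exists n, concentrated_ge n X /\ concentrated_ge n Y.
Proof.
move=> [m hX] [n hY]; exists (Num.min m n).
by split; apply: concentrated_le; try eassumption; rewrite ge_min lexx ?orbT.
Qed.

(** * Twisted extensions of complexes *)

Section Extension.
Variables (A : additive_category) (P V : complex A).
Variable t : forall n : int, hom (P n) (V (n - 1)).
Hypothesis tP : forall n, t (n - 1) ∘ diff P n + diff V (n - 1) ∘ t n = 0.

(** The condition [tP] says that [t] is a chain map from [P] to [shift V]; the extension is a model
    of its homotopy fibre. *)
Definition ext_diff (n : int) :
    hom (biprod (P n) (V n)) (biprod (P (n - 1)) (V (n - 1))) :=
  bpair _ (diff P n ∘ prl _) (t n ∘ prl _ + diff V n ∘ prr _).

Lemma ext_diffE n (W : A) (p : hom W (P n)) (a : hom W (V n)) :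
  ext_diff n ∘ bpair (biprod (P n) (V n)) p a =
  bpair (biprod (P (n - 1)) (V (n - 1))) (diff P n ∘ p) (t n ∘ p + diff V n ∘ a).
Proof.
by rewrite /ext_diff bpair_comp compDl -!comp_assoc prl_bpair prr_bpair.
Qed.

Lemma ext_diff_diff n : ext_diff (n - 1) ∘ ext_diff n = 0.
Proof.
rewrite {2}/ext_diff ext_diffE compDr !comp_assoc diff_diff (diff_diff V n).
by rewrite !comp0l addr0 -compDl tP comp0l bpair0.
Qed.

Definition ext_complex : complex A :=
  @Complex A (fun n => biprod (P n) (V n)) ext_diff ext_diff_diff.

Lemma diff_extE n (W : A) (p : hom W (P n)) (a : hom W (V n)) :
  diff ext_complex n ∘ bpair (biprod (P n) (V n)) p a =
  bpair (biprod (P (n - 1)) (V (n - 1))) (diff P n ∘ p) (t n ∘ p + diff V n ∘ a).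
Proof. exact: ext_diffE. Qed.

Lemma ext_chain_map (Z : complex A)
    (h : forall n, hom (biprod (P n) (V n)) (Z n)) :
  (forall n W (p : hom W (P n)) (a : hom W (V n)),
     h (n - 1) ∘ bpair (biprod (P (n - 1)) (V (n - 1)))
       (diff P n ∘ p) (t n ∘ p + diff V n ∘ a) =
     diff Z n ∘ (h n ∘ bpair (biprod (P n) (V n)) p a)) ->
  forall n, h (n - 1) ∘ diff ext_complex n = diff Z n ∘ h n.
Proof.
move=> e n; set b := biprod (P n) (V n).
rewrite -[LHS](@comp_idr A) -[RHS](@comp_idr A) -!comp_assoc.
rewrite -(eq_bpair_id (b := b) erefl erefl).
by rewrite diff_extE e.
Qed.

Lemma ext_inrP n :
  binr (biprod (P (n - 1)) (V (n - 1))) ∘ diff V n =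
  diff ext_complex n ∘ binr (biprod (P n) (V n)).
Proof.
have -> : binr (biprod (P n) (V n)) = bpair _ 0 (idm _).
  by rewrite /bpair comp0r add0r comp_idr.
by rewrite diff_extE !comp0r add0r comp_idr /bpair comp0r add0r.
Qed.

Definition ext_inr : chain_map V ext_complex :=
  @ChainMap A V ext_complex (fun n => binr (biprod (P n) (V n))) ext_inrP.

Lemma ext_prlP n :
  prl (biprod (P (n - 1)) (V (n - 1))) ∘ diff ext_complex n =
  diff P n ∘ prl (biprod (P n) (V n)).
Proof. exact: prl_bpair. Qed.

Definition ext_prl : chain_map ext_complex P :=
  @ChainMap A ext_complex P (fun n => prl (biprod (P n) (V n))) ext_prlP.

Lemma ext_split n : split_exact (ext_inr n) (ext_prl n).
Proof.
split; first exact: prl_binr.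
exists (prr _), (binl _); split; [exact: prr_binr|exact: prl_binl|].
by rewrite addrC; exact: biproduct_id.
Qed.

Lemma concentrated_ext n :
  concentrated_ge n P -> concentrated_ge n V -> concentrated_ge n ext_complex.
Proof. by move=> hP hV k kn; apply: is_zero_biproduct; [exact: hP|exact: hV]. Qed.

End Extension.

Section ExtensionMap.
Variables (A : additive_category) (P V P' V' : complex A).
Variables (t : forall n : int, hom (P n) (V (n - 1)))
  (t' : forall n : int, hom (P' n) (V' (n - 1))).
Hypothesis tP : forall n, t (n - 1) ∘ diff P n + diff V (n - 1) ∘ t n = 0.
Hypothesis tP' : forall n, t' (n - 1) ∘ diff P' n + diff V' (n - 1) ∘ t' n = 0.
Variables (a : chain_map P P') (b : chain_map V V').
Hypothesis ab : forall n, t' n ∘ a n = b (n - 1) ∘ t n.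

Lemma ext_mapP (n : int) :
  bpair (biprod (P' (n - 1)) (V' (n - 1))) (a (n - 1) ∘ prl _) (b (n - 1) ∘ prr _)
    ∘ diff (ext_complex tP) n =
  diff (ext_complex tP') n ∘
    bpair (biprod (P' n) (V' n)) (a n ∘ prl _) (b n ∘ prr _).
Proof.
apply: (@ext_chain_map _ _ _ _ tP (ext_complex tP')
  (fun n => bpair (biprod (P' n) (V' n)) (a n ∘ prl _) (b n ∘ prr _))) => {}n W p v.
rewrite !bpair_comp compDl -!comp_assoc !(prl_bpair, prr_bpair).
by rewrite compDr !comp_assoc ab !chain_mapP.
Qed.

Definition ext_map : chain_map (ext_complex tP) (ext_complex tP') :=
  @ChainMap A (ext_complex tP) (ext_complex tP') _ ext_mapP.

Lemma ext_mapE n W (p : hom W (P n)) (v : hom W (V n)) :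
  ext_map n ∘ bpair (biprod (P n) (V n)) p v =
  bpair (biprod (P' n) (V' n)) (a n ∘ p) (b n ∘ v).
Proof. by rewrite bpair_comp -!comp_assoc prl_bpair prr_bpair. Qed.

End ExtensionMap.

(* Attaching to [V] a resolution [e] of the cone of [f : V -> S] yields an extension
   [M] of [P] by [V], and [f] extends to [M -> S] with cone isomorphic to [cone e]. *)
Section Attach.
Variables (A : additive_category) (V S : complex A) (f : chain_map V S).
Variables (P : complex A) (e : chain_map P (cone f)).

(** The sign makes the twist cancel the term [f ∘ prl ∘ e] coming from the differential of the cone,
    so that [attach_map] is a chain map. *)
Definition attach_twist (n : int) : hom (P n) (V (n - 1)) :=
  - (prl (biprod (V (n - 1)) (S n)) ∘ e n).

Lemma attach_twistP n :
  attach_twist (n - 1) ∘ diff P n + diff V (n - 1) ∘ attach_twist n = 0.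
Proof.
rewrite /attach_twist compNl -comp_assoc (chain_mapP e n) compNr.
by rewrite comp_assoc (prl_cone_diff f n) compNl opprK comp_assoc subrr.
Qed.

Definition attach : complex A := ext_complex attach_twistP.

Definition attach_deg (n : int) : hom (biprod (P n) (V n)) (S n) :=
  prr (biprod (V (n - 1)) (S n)) ∘ e n ∘ prl _ + f n ∘ prr _.

Lemma attach_mapP (n : int) :
  attach_deg (n - 1) ∘ diff attach n = diff S n ∘ attach_deg n.
Proof.
apply: (@ext_chain_map _ _ _ _ attach_twistP S attach_deg) => {}n W p v.
rewrite /attach_deg.
rewrite !compDl -!comp_assoc !(prl_bpair, prr_bpair) (comp_assoc (e _)) chain_mapP.
rewrite -(comp_assoc (diff (cone f) n)) prr_diff_cone.
rewrite (compDr (f _)) (compDr (diff S n)) /attach_twist compNl compNr.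
rewrite (comp_assoc (f _) (diff V n)) chain_mapP -!comp_assoc addrA; congr (_ + _).
by rewrite addrAC subrr add0r.
Qed.

Definition attach_map : chain_map attach S :=
  @ChainMap A attach S attach_deg attach_mapP.

Lemma attach_mapE n W (p : hom W (P n)) (v : hom W (V n)) :
  attach_map n ∘ bpair (biprod (P n) (V n)) p v =
  prr (biprod (V (n - 1)) (S n)) ∘ (e n ∘ p) + f n ∘ v.
Proof. by rewrite [LHS]compDl -!comp_assoc prl_bpair prr_bpair. Qed.

Lemma attach_map_inr n : attach_map n ∘ ext_inr attach_twistP n = f n.
Proof.
by rewrite [LHS]compDl -!comp_assoc prl_binr prr_binr !comp0r comp_idr add0r.
Qed.

End Attach.

Section AttachQuasiIso.
Variable E : exact_category.
Hypothesis wic : weakly_idempotent_complete E.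
Hypothesis elem : weakly_omega_AdMon_elementary E.
Variables (V S : complex E) (f : chain_map V S).
Variables (P : complex E) (e : chain_map P (cone f)).

(** Reassociating [((p, v), s)] to [(p, (v, s))] carries the cone of [attach_map e] to the cone of
    [e]. It is enough to exhibit the first as a retract of the second. *)
Lemma attach_map_qi : quasi_iso e -> quasi_iso (attach_map e).
Proof.
pose g := attach_map e.
pose B1 n := biprod (attach e (n - 1)) (S n).
pose B2 n := biprod (P (n - 1)) (V (n - 1)).
pose B3 n := biprod (P (n - 1)) (cone f n).
pose B4 n := biprod (V (n - 1)) (S n).
pose a n : hom (cone g n) (cone e n) :=
  bpair (B3 n) (prl (B2 n) ∘ prl (B1 n)) (bpair (B4 n) (prr (B2 n) ∘ prl (B1 n)) (prr
    (B1 n))).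
pose b n : hom (cone e n) (cone g n) :=
  bpair (B1 n) (bpair (B2 n) (prl (B3 n)) (prl (B4 n) ∘ prr (B3 n))) (prr (B4 n) ∘ prr
    (B3 n)).
have aE n W p v s : a n ∘ bpair (B1 n) (bpair (B2 n) p v) s =
  bpair (B3 n) p (bpair (B4 n) v s) :> hom W _.
  by rewrite /a !bpair_comp -!comp_assoc !(prl_bpair, prr_bpair).
have bE n W p v s : b n ∘ bpair (B3 n) p (bpair (B4 n) v s) =
  bpair (B1 n) (bpair (B2 n) p v) s :> hom W _.
  by rewrite /b !bpair_comp -!comp_assoc !(prl_bpair, prr_bpair).
have twE n (W : E) (p : hom W (P n)) (v : hom W (V (n - 1))) : - (attach_twist e n ∘ p
  + v) = prl (B4 n) ∘ (e n ∘ p) - v.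
  by rewrite compNl opprD opprK comp_assoc.
have aP n : a (n - 1) ∘ diff (cone g) n = diff (cone e) n ∘ a n.
  apply: (@cone_chain_map _ _ _ g (cone e) a) => {}n W x s.
  rewrite [x](bpairE (b := B2 n) x); move: (prl _ ∘ x) (prr _ ∘ x) => p v.
  rewrite aE [in LHS]diff_extE attach_mapE !cone_diffE bpairN aE.
  rewrite [in RHS](bpairE (b := B4 (n - 1)) (e (n - 1) ∘ p)) bpairD twE.
  by rewrite addrA.
have bP n : b (n - 1) ∘ diff (cone e) n = diff (cone g) n ∘ b n.
  apply: (@cone_chain_map _ _ _ e (cone g) b) => {}n W p x.
  have [v [s ->]] := cone_elt x.
  rewrite bE !cone_diffE [in RHS]diff_extE attach_mapE.
  rewrite (bpairE (b := B4 (n - 1)) (e (n - 1) ∘ p)) bpairD bE bpairN.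
  by rewrite prr_bpair twE addrA.
apply: (acyclic_retract wic elem (a := ChainMap aP) (b := ChainMap bP)) => n.
rewrite -[LHS](@comp_idr E) -(eq_bpair_id (b := B1 n) erefl erefl).
by rewrite -comp_assoc {1}(bpairE (b := B2 n) (prl (B1 n))) aE bE -bpairE.
Qed.
End AttachQuasiIso.

Definition under (D : preadditive) (X : Chplus D) : complex D := proj1_sig X.

Definition under_map (D : preadditive) (X Y : Chplus D) (f : hom X Y) :
  chain_map (under X) (under Y) := f.

(** * Functorial towers of resolutions inside [B] *)

Section Resolution.
Variable D : exact_category.
Hypothesis wic : weakly_idempotent_complete D.
Hypothesis elem : weakly_omega_AdMon_elementary D.
Variable B : Chplus D -> Prop.
Hypothesis Bext : degreewise_split_extension_closed B.
Variable Qp : functor (Chplus D) (full_sub B).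
Variable eta : nat_trans (comp_functor (full_incl B) Qp) (id_functor (Chplus D)).
Hypothesis eta_qi : forall X : Chplus D, quasi_iso (eta X).
Hypothesis Qp_conc : forall (X : Chplus D) (n : int),
  concentrated_ge n (full_incl _ X) ->
  concentrated_ge n (full_incl _ (full_incl B (Qp X))).
Variable C : category.

(** The source [C] is left arbitrary because the tower is built twice: over [Ch D] for the
    truncations, where functoriality is essential, and over a one-object category for a single
    interleaved sequence. *)
Record stage (S : functor C (Chplus D)) := Stage {
  stage_fun : functor C (full_sub B);
  stage_map : nat_trans (comp_functor (full_incl B) stage_fun) S }.

Definition stage_cx (S : functor C (Chplus D)) (st : stage S) (X : C) : complex D :=
  under (full_incl B (stage_fun st X)).

Definition stage_fmap (S : functor C (Chplus D)) (st : stage S) (X Y : C)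
  (a : hom X Y) : chain_map (stage_cx st X) (stage_cx st Y) :=
  fmap (stage_fun st) a.

Definition stage_chain (S : functor C (Chplus D)) (st : stage S) (X : C) :
  chain_map (stage_cx st X) (under (S X)) := stage_map st X.

Section Step.
Variables (S S' : functor C (Chplus D)) (st : stage S) (s : nat_trans S S').

Local Notation V := (stage_cx st).

Definition step_chain (X : C) : chain_map (V X) (under (S' X)) :=
  chain_map_comp (under_map (s X)) (stage_chain st X).

Lemma step_chain_nat (X Y : C) (a : hom X Y) n :
  step_chain Y n ∘ stage_fmap st a n =
  under_map (fmap S' a) n ∘ step_chain X n.
Proof.
have e1 := congr1 (fun h : chain_map _ _ => h n) (naturality (stage_map st) a).
have e2 := congr1 (fun h : chain_map _ _ => h n) (naturality s a).
transitivity (under_map (s Y) n ∘ (under_map (fmap S a) n ∘ stage_chain st X n)).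
  by rewrite -comp_assoc; congr (_ ∘ _); exact: e1.
by rewrite [RHS]comp_assoc comp_assoc; congr (_ ∘ _); exact: e2.
Qed.

Lemma step_cone_bounded (X : C) : bounded_below (cone (step_chain X)).
Proof.
have [n [h1 h2]] := bounded_below2 (proj2_sig (full_incl B (stage_fun st X)))
  (proj2_sig (S' X)).
by exists n; apply: concentrated_cone.
Qed.

Definition step_cone_obj (X : C) : Chplus D := exist _ _ (step_cone_bounded X).

Definition step_cone_fmap (X Y : C) (a : hom X Y) :
    @hom (Chplus D) (step_cone_obj X) (step_cone_obj Y) :=
  cone_map (step_chain_nat a).

Lemma step_cone_id (X : C) : step_cone_fmap (idm X) = idm (step_cone_obj X).
Proof.
apply: chain_map_ext => n; apply: eq_bpair_id.
  rewrite /stage_fmap fmap_id; exact: comp_idl.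
rewrite /under_map fmap_id; exact: comp_idl.
Qed.

Lemma step_cone_comp (X Y Z : C) (g : hom Y Z) (f : hom X Y) :
  step_cone_fmap (g ∘ f) = step_cone_fmap g ∘ step_cone_fmap f.
Proof.
apply: chain_map_ext => n; rewrite [RHS]cone_mapE [LHS]/=.
by rewrite /stage_fmap /under_map !fmap_comp !comp_assoc.
Qed.

Definition step_cone : functor C (Chplus D) :=
  @Functor C (Chplus D) step_cone_obj step_cone_fmap step_cone_id step_cone_comp.

Definition step_P (X : C) : complex D := under (full_incl B (Qp (step_cone X))).

Definition step_e (X : C) : chain_map (step_P X) (cone (step_chain X)) :=
  eta (step_cone X).

Definition step_Pmap (X Y : C) (a : hom X Y) : chain_map (step_P X) (step_P Y) :=
  fmap Qp (fmap step_cone a).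

Lemma step_e_nat (X Y : C) (a : hom X Y) n :
  step_e Y n ∘ step_Pmap a n = cone_map (step_chain_nat a) n ∘ step_e X n.
Proof.
exact: (congr1 (fun h : chain_map _ _ => h n) (naturality eta (fmap step_cone a))).
Qed.

Definition step_cx (X : C) : complex D := attach (step_e X).

Lemma step_bounded (X : C) : bounded_below (step_cx X).
Proof.
have [n [h1 h2]] := bounded_below2 (proj2_sig (full_incl B (Qp (step_cone X))))
  (proj2_sig (full_incl B (stage_fun st X))).
by exists n; apply: concentrated_ext.
Qed.

Definition step_obj0 (X : C) : Chplus D := exist _ _ (step_bounded X).

Lemma step_B (X : C) : B (step_obj0 X).
Proof.
apply: (Bext (X := full_incl B (stage_fun st X)) (Y := step_obj0 X)
  (Z := full_incl B (Qp (step_cone X)))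
  (f := ext_inr (attach_twistP (step_e X))) (g := ext_prl (attach_twistP (step_e X)))).
- by move=> n; exact: ext_split.
- exact: proj2_sig (stage_fun st X).
- exact: proj2_sig (Qp (step_cone X)).
Qed.

Definition step_obj (X : C) : full_sub B := exist _ _ (step_B X).

Lemma step_twist_nat (X Y : C) (a : hom X Y) n :
  attach_twist (step_e Y) n ∘ step_Pmap a n =
  stage_fmap st a (n - 1) ∘ attach_twist (step_e X) n.
Proof.
rewrite /attach_twist compNl compNr -comp_assoc step_e_nat; congr (- _).
by rewrite !comp_assoc prl_bpair.
Qed.

Definition step_fmap (X Y : C) (a : hom X Y) :
    @hom (full_sub B) (step_obj X) (step_obj Y) :=
  ext_map (attach_twistP (step_e X)) (attach_twistP (step_e Y)) (step_twist_nat a).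

Lemma step_fmap_id (X : C) : step_fmap (idm X) = idm (step_obj X).
Proof.
apply: chain_map_ext => n; apply: eq_bpair_id.
  by rewrite /step_Pmap !fmap_id; exact: comp_idl.
by rewrite /stage_fmap fmap_id; exact: comp_idl.
Qed.

Lemma step_fmap_comp (X Y Z : C) (g : hom Y Z) (f : hom X Y) :
  step_fmap (g ∘ f) = step_fmap g ∘ step_fmap f.
Proof.
apply: chain_map_ext => n; rewrite [RHS]ext_mapE [LHS]/=.
by rewrite /step_Pmap /stage_fmap !fmap_comp !comp_assoc.
Qed.

Definition step_fun : functor C (full_sub B) :=
  @Functor C (full_sub B) step_obj step_fmap step_fmap_id step_fmap_comp.

Lemma step_map_nat (X Y : C) (a : hom X Y) :
  (attach_map (step_e Y) : @hom (Chplus D) (full_incl B (step_fun Y)) (S' Y)) ∘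
    fmap (comp_functor (full_incl B) step_fun) a =
  fmap S' a ∘ (attach_map (step_e X) : @hom (Chplus D) (full_incl B (step_fun X)) (S' X)).
Proof.
apply: chain_map_ext => n; apply: etrans (attach_mapE _ _ _) _.
rewrite (comp_assoc (step_e Y n)) step_e_nat (comp_assoc (step_chain Y n)) step_chain_nat.
rewrite -!comp_assoc (comp_assoc (prr _) (cone_map _ _)) [_ ∘ cone_map _ n]prr_bpair.
transitivity (under_map (fmap S' a) n ∘ attach_deg (step_e X) n); last by [].
rewrite /attach_deg compDr -!comp_assoc; congr (_ + _).
Qed.

Definition step_stage : stage S' :=
  @Stage S' step_fun (@NatTrans _ _ (comp_functor (full_incl B) step_fun) S' _
    step_map_nat).

Definition step_incl (X : C) : chain_map (V X) (stage_cx step_stage X) :=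
  ext_inr (attach_twistP (step_e X)).

Lemma step_incl_nat (X Y : C) (a : hom X Y) n :
  step_incl Y n ∘ stage_fmap st a n = stage_fmap step_stage a n ∘ step_incl X n.
Proof.
transitivity (bpair (biprod (step_P Y n) (V Y n)) (step_Pmap a n ∘ prl _)
  (stage_fmap st a n ∘ prr _) ∘ binr (biprod (step_P X n) (V X n))); last by [].
rewrite bpair_comp -!comp_assoc prl_binr prr_binr comp0r comp_idr.
by rewrite /bpair comp0r add0r.
Qed.

(** The attached complex resolves the whole cone of the previous map into [S' X], so the new map has
    the acyclic cone of [step_e], up to isomorphism. *)
Lemma step_stage_qi (X : C) : quasi_iso (stage_chain step_stage X).
Proof. by apply: attach_map_qi => //; exact: eta_qi. Qed.

Lemma step_stage_incl (X : C) n :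
  stage_chain step_stage X n ∘ step_incl X n = under_map (s X) n ∘ stage_chain st X n.
Proof. exact: attach_map_inr. Qed.

Lemma step_conc (X : C) n : concentrated_ge n (V X) ->
  concentrated_ge n (under (S' X)) -> concentrated_ge n (stage_cx step_stage X).
Proof.
move=> h1 h2; apply: concentrated_ext => //.
by apply: (Qp_conc (X := step_cone X)); exact: concentrated_cone.
Qed.

End Step.

Section Sequence.
Variable S : nat -> functor C (Chplus D).
Variable s : forall n, nat_trans (S n) (S n.+1).

Lemma base_map_nat (X Y : C) (a : hom X Y) :
  (eta (S 0%N Y) : @hom (Chplus D) (full_incl B (comp_functor Qp (S 0%N) Y)) (S 0%N Y)) ∘
    fmap (comp_functor (full_incl B) (comp_functor Qp (S 0%N))) a =
  fmap (S 0%N) a ∘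
    (eta (S 0%N X) : @hom (Chplus D) (full_incl B (comp_functor Qp (S 0%N) X)) (S 0%N X)).
Proof. exact: (naturality eta (fmap (S 0%N) a)). Qed.

Definition base_stage : stage (S 0%N) :=
  @Stage (S 0%N) (comp_functor Qp (S 0%N)) (@NatTrans _ _
    (comp_functor (full_incl B) (comp_functor Qp (S 0%N))) (S 0%N) _ base_map_nat).

Fixpoint stages (n : nat) : stage (S n) :=
  match n with 0 => base_stage | m.+1 => step_stage (stages m) (s m) end.

Definition res_fun (n : nat) : functor C (full_sub B) := stage_fun (stages n).

Definition res (n : nat) (X : C) : Ch D := stage_cx (stages n) X.

Definition res_fmap n (X Y : C) (a : hom X Y) : hom (res n X) (res n Y) :=
  stage_fmap (stages n) a.

Definition res_map n (X : C) : hom (res n X) (under (S n X) : Ch D) :=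
  stage_chain (stages n) X.

Definition res_incl n (X : C) : hom (res n X) (res n.+1 X) :=
  step_incl (stages n) (s n) X.

Lemma res_map_qi n (X : C) : quasi_iso (res_map n X).
Proof. by case: n => [|n]; [exact: eta_qi|exact: step_stage_qi]. Qed.

Lemma res_map_incl n (X : C) :
  res_map n.+1 X ∘ res_incl n X = (under_map (s n X) : @hom (Ch D) _ _) ∘ res_map n X.
Proof. by apply: chain_map_ext => k; exact: step_stage_incl. Qed.

Lemma res_incl_nat n (X Y : C) (a : hom X Y) :
  res_incl n Y ∘ res_fmap n a = res_fmap n.+1 a ∘ res_incl n X.
Proof. by apply: chain_map_ext => k; exact: step_incl_nat. Qed.

Lemma res_map_nat n (X Y : C) (a : hom X Y) :
  res_map n Y ∘ res_fmap n a = (under_map (fmap (S n) a) : @hom (Ch D) _ _) ∘ res_map n X.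
Proof. exact: (naturality (stage_map (stages n)) a). Qed.

Lemma res_fmap_id n (X : C) : res_fmap n (idm X) = idm (res n X).
Proof. exact: (fmap_id (res_fun n)). Qed.

Lemma res_fmap_comp n (X Y Z : C) (g : hom Y Z) (f : hom X Y) :
  res_fmap n (g ∘ f) = res_fmap n g ∘ res_fmap n f.
Proof. exact: (fmap_comp (res_fun n)). Qed.

(** Each stage contains the previous one, so the bounds must be non-increasing. Forming cones and
    applying [Qp] keep the bound. *)
Lemma res_conc (m : nat -> int) (X : C) :
  (forall n, m n.+1 <= m n) -> (forall n, concentrated_ge (m n) (under (S n X))) ->
  forall n, concentrated_ge (m n) (res n X : complex D).
Proof.
move=> hm hS; elim=> [|n IH]; first exact: (Qp_conc (X := S 0%N X)).
by apply: step_conc => //; apply: concentrated_le IH.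
Qed.

Definition res_diagram (X : C) : omega_diagram (Ch D) :=
  @OmegaDiagram (Ch D) (fun n => res n X) (fun n => res_incl n X).

Lemma res_incl_split (X : C) (n : nat) k : split_mono (at_deg (res_incl n X) k).
Proof. exact: binr_split_mono. Qed.

End Sequence.
End Resolution.

(** * The deformation *)

Section ChQuasiIso.
Variable E : exact_category.
Hypothesis wic : weakly_idempotent_complete E.
Hypothesis elem : weakly_omega_AdMon_elementary E.
Variables (X Y Z : Ch E) (f : hom X Y) (g : hom Y Z).

Lemma Ch_qi_comp : quasi_iso f -> quasi_iso g -> quasi_iso (g ∘ f).
Proof. by apply: qi_comp. Qed.

Lemma Ch_qi_left : quasi_iso g -> quasi_iso (g ∘ f) -> quasi_iso f.
Proof. by apply: qi_cancel_left. Qed.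

Lemma Ch_qi_right : quasi_iso f -> quasi_iso (g ∘ f) -> quasi_iso g.
Proof. by apply: qi_cancel_right. Qed.

End ChQuasiIso.

Lemma fmap_is_iso (C C' : category) (G : functor C C') (X Y : C) (f : hom X Y) :
  is_iso f -> is_iso (fmap G f).
Proof. by case=> g [gf fg]; exists (fmap G g); rewrite -!fmap_comp gf fg !fmap_id. Qed.

Definition unit_category : category :=
  @Category unit (fun _ _ => unit) (fun=> tt) (fun _ _ _ _ _ => tt)
    (fun _ _ f => match f with tt => erefl end)
    (fun _ _ f => match f with tt => erefl end)
    (fun _ _ _ _ _ _ _ => erefl).

Section Constant.
Variable C : category.

Definition const_functor (X : C) : functor unit_category C :=
  @Functor unit_category C (fun=> X) (fun _ _ _ => idm X) (fun=> erefl)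
    (fun _ _ _ _ _ => esym (comp_idl (idm X))).

Lemma const_nat_transP (X Y : C) (f : hom X Y) (i j : unit_category) (a : hom i j) :
  f ∘ fmap (const_functor X) a = fmap (const_functor Y) a ∘ f.
Proof. by rewrite comp_idr comp_idl. Qed.

Definition const_nat_trans (X Y : C) (f : hom X Y) :
    nat_trans (const_functor X) (const_functor Y) :=
  @NatTrans _ _ (const_functor X) (const_functor Y) (fun=> f) (const_nat_transP f).

End Constant.

Section Main.
Variables (D E : exact_category) (F : additive_functor D E).
Variables (T : left_truncation_system D) (B : Chplus D -> Prop).
Hypothesis wicD : weakly_idempotent_complete D.
Hypothesis wicE : weakly_idempotent_complete E.
Hypothesis elemD : weakly_omega_AdMon_elementary D.
Hypothesis elemE : weakly_omega_AdMon_elementary E.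
Hypothesis Tcomplete : homologically_right_complete T.
Hypothesis Tadm : admissible_truncation T.
Hypothesis Fcop : preserves_countable_coproducts F.
Hypothesis Bext : degreewise_split_extension_closed B.
Variable Qp : functor (Chplus D) (full_sub B).
Variable rho : nat_trans (comp_functor (full_incl B) Qp) (id_functor (Chplus D)).
Hypothesis rho_qi : forall X : Chplus D, quasi_iso (rho X).
Hypothesis Qp_conc : forall (X : Chplus D) (n : int),
  concentrated_ge n (full_incl _ X) ->
  concentrated_ge n (full_incl _ (full_incl B (Qp X))).
Hypothesis FB : forall (X Y : Chplus D) (f : hom X Y), B X -> B Y ->
  quasi_iso f -> quasi_iso (fmap (Ch_functor F) (fmap (full_incl _) f)).

Local Notation CF := (Ch_functor F).

Definition in_B (X : Ch D) : Prop := exists h : bounded_below X, B (exist _ X h).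

Lemma in_B_under (X : full_sub B) : in_B (under (full_incl B X)).
Proof. by case: X => -[X hX] BX; exists hX. Qed.

Lemma F_qi (X Y : Ch D) (f : hom X Y) :
  in_B X -> in_B Y -> quasi_iso f -> quasi_iso (fmap CF f).
Proof.
move=> [hX BX] [hY BY] qf.
exact: (FB (X := exist _ X hX) (Y := exist _ Y hY) (f := f) BX BY qf).
Qed.

Section Diagrams.
Variables (C : category) (S : nat -> functor C (Chplus D)).
Variable s : forall n, nat_trans (S n) (S n.+1).

Local Notation R n X := (res Bext rho s n X).
Local Notation RD X := (res_diagram Bext rho s X).

Lemma res_in_B n X : in_B (R n X).
Proof. exact: (in_B_under (res_fun Bext rho s n X)). Qed.

Lemma res_eventually_adm_mono X : eventually_adm_mono (RD X).
Proof. by move=> k; exists 0%N => n _; apply: split_mono_adm; exact: res_incl_split. Qed.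

(** An additive functor need not preserve admissible monomorphisms, but it preserves split ones.
    This is why the tower is built from degreewise split extensions. *)
Lemma F_res_eventually_adm_mono X : eventually_adm_mono (map_diagram CF (RD X)).
Proof.
move=> k; exists 0%N => n _; apply: split_mono_adm.
by apply: (@fmap_split_mono D E F); exact: res_incl_split.
Qed.

Lemma res_colimit_exists X :
  exists (L : Ch D) (c : forall n, hom (RD X n) L), degreewise_colimit c.
Proof.
apply: degreewise_colimit_exists => k; apply: elemD.1 => n.
by apply: split_mono_adm; exact: res_incl_split.
Qed.

Lemma F_res_colimit X (L : Ch D) (c : forall n, hom (RD X n) L) :
  degreewise_colimit c ->
  degreewise_colimit (K := map_diagram CF (RD X)) (fun n => fmap CF (c n)).
Proof.
move=> hc k.
apply: (@fmap_split_colimit D E F (deg_diagram (RD X) k)) => // n.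
exact: res_incl_split.
Qed.

End Diagrams.

Lemma trunc_bounded n (X : Ch D) : bounded_below (trunc T n X).
Proof. by exists (- n%:Z); exact: trunc_conc. Qed.

Definition trunc_plus_obj n (X : Ch D) : Chplus D :=
  exist _ (trunc T n X) (trunc_bounded n X).

Definition trunc_plus n : functor (Ch D) (Chplus D) :=
  @Functor (Ch D) (Chplus D) (trunc_plus_obj n) (fun X Y f => fmap (trunc T n) f)
    (fmap_id (trunc T n)) (fun X Y Z g f => fmap_comp (trunc T n) g f).

Definition trunc_plus_map n : nat_trans (trunc_plus n) (trunc_plus n.+1) :=
  @NatTrans _ _ (trunc_plus n) (trunc_plus n.+1) (fun X => trunc_map T n X)
    (fun X Y f => naturality (trunc_map T n) f).

Local Notation V n X := (res Bext rho trunc_plus_map n X).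
Local Notation VD X := (res_diagram Bext rho trunc_plus_map X).
Local Notation Vmap n f := (res_fmap Bext rho trunc_plus_map n f).
Local Notation Vincl n X := (res_incl Bext rho trunc_plus_map n X).

Definition phi n (X : Ch D) : hom (V n X) (trunc T n X) :=
  res_map Bext rho trunc_plus_map n X.

Lemma phi_qi n X : quasi_iso (phi n X).
Proof. exact: res_map_qi. Qed.

Lemma phi_incl n X : phi n.+1 X ∘ Vincl n X = trunc_map T n X ∘ phi n X.
Proof. exact: res_map_incl. Qed.

Lemma phi_nat n (X Y : Ch D) (f : hom X Y) :
  phi n Y ∘ Vmap n f = fmap (trunc T n) f ∘ phi n X.
Proof. exact: res_map_nat. Qed.

Definition alpha n X : hom (V n X) X := trunc_psi T n X ∘ phi n X.

Lemma alpha_incl n X : alpha n.+1 X ∘ Vincl n X = alpha n X.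
Proof. by rewrite /alpha -comp_assoc phi_incl comp_assoc trunc_compat. Qed.

Lemma alpha_nat n (X Y : Ch D) (f : hom X Y) :
  alpha n Y ∘ Vmap n f = f ∘ alpha n X.
Proof.
rewrite /alpha -comp_assoc phi_nat !comp_assoc; congr (_ ∘ _).
exact: (naturality (trunc_psi T n) f).
Qed.

Lemma V_conc n X : concentrated_ge (- n%:Z) (V n X : complex D).
Proof.
apply: (@res_conc D B Bext Qp rho Qp_conc (Ch D) trunc_plus trunc_plus_map (fun n => -
  n%:Z)).
  by move=> m; rewrite lerN2 lez_nat.
by move=> m; exact: trunc_conc.
Qed.

Lemma alpha_qi n X : concentrated_ge (- n%:Z) X -> quasi_iso (alpha n X).
Proof.
by move=> hX; apply: Ch_qi_comp => //; [exact: phi_qi|exact: trunc_quasi_iso].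
Qed.

Lemma Vmap_qi_trunc n (X Y : Ch D) (f : hom X Y) :
  quasi_iso (fmap (trunc T n) f) -> quasi_iso (Vmap n f).
Proof.
move=> qf; apply: (Ch_qi_left wicD elemD (g := phi n Y)); first exact: phi_qi.
by rewrite phi_nat; apply: Ch_qi_comp => //; exact: phi_qi.
Qed.

Lemma Vmap_qi n (X Y : Ch D) (f : hom X Y) : quasi_iso f -> quasi_iso (Vmap n f).
Proof. by move=> qf; apply: Vmap_qi_trunc; exact: trunc_preserves. Qed.

Lemma trunc_eventually_adm_mono X : eventually_adm_mono (trunc_diagram T X).
Proof.
move=> k; exists (`|k|.+1)%N => n hn; apply: Tadm.
rewrite ltrNl; apply: le_lt_trans (ler_norm _) _; rewrite normrN -abszE ltz_nat.
exact: hn.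
Qed.

(** * The colimit [Q] of the tower and its map to the identity *)

Section Resolved.
Variables (Q : Ch D -> Ch D) (c : forall X n, hom (VD X n) (Q X)).
Hypothesis hc : forall X, degreewise_colimit (c X).

Let hc' X : is_colimit (c X) := degreewise_colimitP (hc X).

Lemma Q_ext X W (u v : hom (Q X) W) : (forall n, u ∘ c X n = v ∘ c X n) -> u = v.
Proof. exact: (colimit_ext (hc' X)). Qed.

Lemma Q_fmap_exists (X Y : Ch D) (f : hom X Y) :
  exists w : hom (Q X) (Q Y), forall n, w ∘ c X n = c Y n ∘ Vmap n f.
Proof.
apply: (colimit_lift (hc' X)) => n.
rewrite -comp_assoc -(res_incl_nat Bext rho trunc_plus_map n f) comp_assoc.
by congr (_ ∘ _); exact: (hc' Y).1.
Qed.

(** The colimit [L] of the truncations is given in [Ch D] only, so it is first identified with a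
    degreewise colimit [L']. The map from [Q X] to [L'] is a colimit of the quasi-isomorphisms
    [phi n X], and [L] maps to [X] by a quasi-isomorphism. *)
Lemma Q_eta_exists X :
  exists2 eta : hom (Q X) X, quasi_iso eta & forall n, eta ∘ c X n = alpha n X.
Proof.
have [L [cL [u [hL hu qu]]]] := Tcomplete X.
have [L' [c' hc1]] : exists (L' : Ch D) (c' : forall n, hom (trunc_diagram T X n) L'),
    degreewise_colimit c'.
  apply: degreewise_colimit_exists => k.
  have [N hN] := @trunc_eventually_adm_mono X k.
  exact: (eventually_adm_mono_colimit elemD (X := deg_diagram (trunc_diagram T X) k) hN).
have [w iso_w hw] := colimit_unique (degreewise_colimitP hc1) hL.
have [|g hg] := colimit_lift (hc' X) (u := fun n => c' n ∘ phi n X).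
  move=> n; rewrite -comp_assoc [phi _ _ ∘ _]phi_incl comp_assoc.
  by congr (_ ∘ _); exact: (degreewise_colimitP hc1).1.
exists (u ∘ (w ∘ g)).
  apply: Ch_qi_comp => //; apply: Ch_qi_comp => //; last exact: qi_iso.
  apply: (qi_colimit wicD elemD (X := VD X) (Y := trunc_diagram T X) (cX := c X) (cY :=
    c')
    (f := fun n => phi n X) _ hg (hc X) hc1).
  - by move=> n; exact: phi_incl.
  - exact: res_eventually_adm_mono.
  - exact: trunc_eventually_adm_mono.
  - by move=> n; exists n => //; exact: phi_qi.
by move=> n; rewrite -!comp_assoc hg (comp_assoc w) hw comp_assoc hu.
Qed.

Variable Qmap : forall X Y (f : hom X Y), hom (Q X) (Q Y).
Hypothesis QmapE : forall X Y (f : hom X Y) n, Qmap f ∘ c X n = c Y n ∘ Vmap n f.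
Variable eta : forall X, hom (Q X) X.
Hypothesis eta_qi : forall X, quasi_iso (eta X).
Hypothesis etaE : forall X n, eta X ∘ c X n = alpha n X.

Lemma Qmap_id X : Qmap (idm X) = idm (Q X).
Proof.
apply: Q_ext => n; rewrite QmapE comp_idl.
by rewrite res_fmap_id comp_idr.
Qed.

Lemma Qmap_comp X Y Z (g : hom Y Z) (f : hom X Y) : Qmap (g ∘ f) = Qmap g ∘ Qmap f.
Proof.
apply: Q_ext => n; rewrite QmapE -comp_assoc QmapE comp_assoc QmapE.
by rewrite res_fmap_comp comp_assoc.
Qed.

Lemma eta_nat X Y (f : hom X Y) : eta Y ∘ Qmap f = f ∘ eta X.
Proof.
apply: Q_ext => n; rewrite -!comp_assoc QmapE etaE comp_assoc etaE.
exact: alpha_nat.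
Qed.

(** On each stage the map induced by [f] is a quasi-isomorphism between objects of [B], which [F]
    preserves; the colimit of these is [F] applied to [Qmap f]. *)
Lemma FQ_qi (X Y : Ch D) (f : hom X Y) : quasi_iso f -> quasi_iso (fmap CF (Qmap f)).
Proof.
move=> qf.
apply: (qi_colimit wicE elemE (X := map_diagram CF (VD X)) (Y := map_diagram CF (VD Y))
  (cX := fun n => fmap CF (c X n)) (cY := fun n => fmap CF (c Y n))
  (f := fun n => fmap CF (Vmap n f))).
- by move=> n; rewrite -!(fmap_comp CF); congr (fmap CF _); exact/esym/res_incl_nat.
- by move=> n; rewrite -!(fmap_comp CF) QmapE.
- exact: F_res_colimit.
- exact: F_res_colimit.
- exact: F_res_eventually_adm_mono.
- exact: F_res_eventually_adm_mono.
- move=> n; exists n => //; apply: F_qi; [exact: res_in_B|exact: res_in_B|].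
  exact: Vmap_qi.
Qed.

(* Enumerates (0,0), (0,1), (1,1), (1,2), (2,2), ... *)
Definition zigzag_next (p : nat * nat) : nat * nat :=
  if (p.2 <= p.1)%N then (p.1, p.2.+1) else (p.1.+1, p.2).

Fixpoint zigzag (k : nat) : nat * nat :=
  if k is k'.+1 then zigzag_next (zigzag k') else (0%N, 0%N).

Lemma zigzag_double k : zigzag k.*2 = (k, k).
Proof. by elim: k => // k IH; rewrite doubleS /= IH /zigzag_next /= leqnn ltnn. Qed.

Lemma zigzag_doubleS k : zigzag k.*2.+1 = (k, k.+1).
Proof. by rewrite /= zigzag_double /zigzag_next /= leqnn. Qed.

(** * The interleaved sequence comparing [Q (Q X)] with [Q X] *)

Section ZigZag.
Variable X : Ch D.
Let Y := Q X.

Definition zz_obj (p : nat * nat) : Ch D := V p.1 (V p.2 X).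

(** Matching on the test made by [zigzag_next] lets the target type reduce in each branch; the next
    two definitions use the same device. *)
Definition zz_map (p : nat * nat) : hom (zz_obj p) (zz_obj (zigzag_next p)) :=
  match (p.2 <= p.1)%N as b
    return hom (zz_obj p) (zz_obj (if b then (p.1, p.2.+1) else (p.1.+1, p.2))) with
  | true => Vmap p.1 (Vincl p.2 X)
  | false => Vincl p.1 (V p.2 X)
  end.

Definition zz_right (p : nat * nat) : hom (V p.2 X) (V (zigzag_next p).2 X) :=
  match (p.2 <= p.1)%N as b
    return hom (V p.2 X) (V (if b then (p.1, p.2.+1) else (p.1.+1, p.2)).2 X) with
  | true => Vincl p.2 X
  | false => idm (V p.2 X)
  end.

Definition zz_left (Z : Ch D) (p : nat * nat) : hom (V p.1 Z) (V (zigzag_next p).1 Z) :=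
  match (p.2 <= p.1)%N as b
    return hom (V p.1 Z) (V (if b then (p.1, p.2.+1) else (p.1.+1, p.2)).1 Z) with
  | true => idm (V p.1 Z)
  | false => Vincl p.1 Z
  end.

Definition zz_alpha (p : nat * nat) : hom (zz_obj p) (V p.2 X) := alpha p.1 (V p.2 X).

Definition zz_beta (p : nat * nat) : hom (zz_obj p) (V p.1 Y) := Vmap p.1 (c X p.2).

Lemma zz_alpha_map p :
  zz_alpha (zigzag_next p) ∘ zz_map p = zz_right p ∘ zz_alpha p.
Proof.
case: p => a b; rewrite /zz_alpha /zz_map /zz_right /zigzag_next /zz_obj.
case: (b <= a)%N => /=; first exact: alpha_nat.
by rewrite comp_idl alpha_incl.
Qed.

Lemma zz_beta_map p :
  zz_beta (zigzag_next p) ∘ zz_map p = zz_left Y p ∘ zz_beta p.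
Proof.
case: p => a b; rewrite /zz_beta /zz_map /zz_left /zigzag_next /zz_obj.
case: (b <= a)%N => /=; last by rewrite res_incl_nat.
rewrite comp_idl -res_fmap_comp; congr (res_fmap _ _ _ _ _).
exact: (hc' X).1.
Qed.

Lemma zz_right_transition p : transition (X := VD X) (zz_right p).
Proof.
case: p => a b; rewrite /zz_right /zigzag_next.
case: (b <= a)%N => /=; last exact: transition_id.
rewrite -[res_incl _ _ _ _ _](@comp_idr (Ch D)).
by apply: (@transitionS _ (VD X) b b); exact: transition_id.
Qed.

Lemma zz_left_transition Z p : transition (X := VD Z) (zz_left Z p).
Proof.
case: p => a b; rewrite /zz_left /zigzag_next.
case: (b <= a)%N => /=; first exact: transition_id.
rewrite -[res_incl _ _ _ _ _](@comp_idr (Ch D)).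
by apply: (@transitionS _ (VD Z) a a); exact: transition_id.
Qed.

(** [V_b X] lives in degrees at least [- b], hence at least [- a] when [b <= a], and there the
    truncation [T_a] changes nothing up to quasi-isomorphism. *)
Lemma zz_alpha_qi p : (p.2 <= p.1)%N -> quasi_iso (zz_alpha p).
Proof.
move=> h; apply: alpha_qi.
apply: (@concentrated_le D _ (- p.1%:Z) (- p.2%:Z) _ (@V_conc p.2 X)).
by rewrite lerN2 lez_nat.
Qed.

(** After [T_a], the composite of [c X a.+1] with [eta X] is the image of [phi a.+1] followed by the
    image of [trunc_psi a.+1]. The first is a quasi-isomorphism since [T_a] preserves them, the
    second by [trunc_trunc]; then [T_a (eta X)] is cancelled. *)
Lemma zz_beta_qi a : quasi_iso (zz_beta (a, a.+1)).
Proof.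
suff : quasi_iso (Vmap a (c X a.+1)) by [].
apply: Vmap_qi_trunc; apply: (Ch_qi_left wicD elemD (g := fmap (trunc T a) (eta X))).
  exact: trunc_preserves.
rewrite -fmap_comp etaE /alpha fmap_comp; apply: Ch_qi_comp => //.
  apply: trunc_preserves; exact: phi_qi.
exact: trunc_trunc.
Qed.

Lemma zz_bounded p : bounded_below (zz_obj p).
Proof. by have [h _] := res_in_B trunc_plus_map p.1 (V p.2 X). Qed.

Definition zz_plus (p : nat * nat) : Chplus D := exist _ (zz_obj p) (zz_bounded p).

Definition zz_fun (k : nat) : functor unit_category (Chplus D) :=
  const_functor (zz_plus (zigzag k)).

Definition zz_trans (k : nat) : nat_trans (zz_fun k) (zz_fun k.+1) :=
  @const_nat_trans (Chplus D) (zz_plus (zigzag k)) (zz_plus (zigzag k.+1)) (zz_map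
    (zigzag k)).

Local Notation W k := (res Bext rho zz_trans k tt).

Definition zz_res k : hom (W k) (zz_obj (zigzag k)) := res_map Bext rho zz_trans k tt.

(** The colimit [L] of the resolved zigzag maps to [Y] by [g] and to [Q Y] by [h], with
    [eta Y ∘ h = g]. Both become quasi-isomorphisms under [F], so [F (eta Y)] is one by
    cancellation. *)
Lemma F_eta_Q_qi : quasi_iso (fmap CF (eta Y)).
Proof.
have [L [cL hL]] := res_colimit_exists zz_trans tt.
pose WD := res_diagram Bext rho zz_trans tt.
have hL' := degreewise_colimitP hL.
have zz_res_incl k : zz_res k.+1 ∘ dmap WD k = zz_map (zigzag k) ∘ zz_res k.
  exact: res_map_incl.
pose a k : hom (WD k) (V (zigzag k).2 X) := zz_alpha (zigzag k) ∘ zz_res k.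
pose b k : hom (WD k) (V (zigzag k).1 Y) := zz_beta (zigzag k) ∘ zz_res k.
have aS k : a k.+1 ∘ dmap WD k = zz_right (zigzag k) ∘ a k.
  by rewrite /a -comp_assoc zz_res_incl comp_assoc zz_alpha_map -comp_assoc.
have bS k : b k.+1 ∘ dmap WD k = zz_left Y (zigzag k) ∘ b k.
  by rewrite /b -comp_assoc zz_res_incl comp_assoc zz_beta_map -comp_assoc.
have [|g hg] := colimit_lift hL' (u := fun k => c X (zigzag k).2 ∘ a k).
  move=> k; rewrite -comp_assoc aS comp_assoc; congr (_ ∘ _).
  exact: (transition_cocone (hc' X).1 (zz_right_transition _)).
have [|h hh] := colimit_lift hL' (u := fun k => c Y (zigzag k).1 ∘ b k).
  move=> k; rewrite -comp_assoc bS comp_assoc; congr (_ ∘ _).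
  exact: (transition_cocone (hc' Y).1 (zz_left_transition Y _)).
have eta_h : eta Y ∘ h = g.
  apply: (colimit_ext hL') => k; rewrite -comp_assoc hh hg comp_assoc etaE.
  by rewrite /a /b /zz_beta (comp_assoc (alpha _ _)) alpha_nat -comp_assoc.
have WB k : in_B (W k) by exact: res_in_B.
have VB n Z : in_B (V n Z) by exact: res_in_B.
have Fmono := F_res_eventually_adm_mono zz_trans tt.
(* Even positions carry the pairs [(n, n)], where [alpha] is a quasi-isomorphism; odd positions
   carry [(n, n.+1)], where [zz_beta_qi] applies. Replacing the zigzag by its resolution puts both
   source and target in [B]. *)
have even n : exists2 m, (n <= m)%N & quasi_iso (fmap CF (a m)).
  exists n.*2; first by rewrite -addnn leq_addr.
  apply: (F_qi (WB _) (VB _ _)).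
  apply: (Ch_qi_comp wicD elemD); first exact: res_map_qi.
  by apply: zz_alpha_qi; rewrite zigzag_double.
have odd n : exists2 m, (n <= m)%N & quasi_iso (fmap CF (b m)).
  exists n.*2.+1; first by rewrite -addnn ltnW // ltnS leq_addr.
  apply: (F_qi (WB _) (VB _ _)).
  apply: (Ch_qi_comp wicD elemD); first exact: res_map_qi.
  by rewrite zigzag_doubleS; exact: zz_beta_qi.
have transition_adm Z n m (t : hom (VD Z n) (VD Z m)) k : transition t ->
    adm_mono (at_deg (fmap CF t) k).
  move=> ht; have := transition_deg k (transition_map CF ht).
  apply: (@transition_adm_mono E (deg_diagram (map_diagram CF (VD Z)) k) 0) => // i _.
  by apply: split_mono_adm; apply: (@fmap_split_mono D E F); exact: res_incl_split.
have Fg : quasi_iso (fmap CF g).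
  (* Each coordinate of the zigzag is non-decreasing and unbounded, so [R] runs through the tower of
     [X] with repetitions and has the same colimit. *)
  pose R := @OmegaDiagram (Ch D) (fun k => V (zigzag k).2 X) (fun k => zz_right (zigzag
    k)).
  apply: (qi_colimit wicE elemE (X := map_diagram CF WD) (Y := map_diagram CF R)
    (cX := fun n => fmap CF (cL n)) (cY := fun n => fmap CF (c X (zigzag n).2))
    (f := fun n => fmap CF (a n))) => //.
  - by move=> n; rewrite -!(fmap_comp CF); congr (fmap CF _); exact: aS.
  - by move=> n; rewrite -!(fmap_comp CF) hg.
  - exact: F_res_colimit.
  - move=> k; apply: (@cofinal_colimit E (deg_diagram (map_diagram CF (VD X)) k)
      (fun i => (zigzag i).2) (fun i => at_deg (fmap CF (zz_right (zigzag i))) k)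
      _ (fun n => at_deg (fmap CF (c X n)) k)).
    + by move=> n; exists n.*2; rewrite zigzag_double.
    + move=> i; apply: transition_deg; apply: transition_map; exact: zz_right_transition.
    + exact: F_res_colimit.
  - move=> k; exists 0%N => n _; apply: transition_adm; exact: zz_right_transition.
have Fh : quasi_iso (fmap CF h).
  pose R := @OmegaDiagram (Ch D) (fun k => V (zigzag k).1 Y) (fun k => zz_left Y
    (zigzag k)).
  apply: (qi_colimit wicE elemE (X := map_diagram CF WD) (Y := map_diagram CF R)
    (cX := fun n => fmap CF (cL n)) (cY := fun n => fmap CF (c Y (zigzag n).1))
    (f := fun n => fmap CF (b n))) => //.
  - by move=> n; rewrite -!(fmap_comp CF); congr (fmap CF _); exact: bS.
  - by move=> n; rewrite -!(fmap_comp CF) hh.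
  - exact: F_res_colimit.
  - move=> k; apply: (@cofinal_colimit E (deg_diagram (map_diagram CF (VD Y)) k)
      (fun i => (zigzag i).1) (fun i => at_deg (fmap CF (zz_left Y (zigzag i))) k)
      _ (fun n => at_deg (fmap CF (c Y n)) k)).
    + by move=> n; exists n.*2; rewrite zigzag_double.
    + move=> i; apply: transition_deg; apply: transition_map; exact: zz_left_transition.
    + exact: F_res_colimit.
  - move=> k; exists 0%N => n _; apply: transition_adm; exact: zz_left_transition.
by apply: (Ch_qi_right wicE elemE (f := fmap CF h)) => //; rewrite -fmap_comp eta_h.
Qed.

End ZigZag.
End Resolved.
End Main.

Theorem theorem3p22 (D E : exact_category) (F : additive_functor D E)
  (T : left_truncation_system D) (B : Chplus D -> Prop) :
  weakly_idempotent_complete D -> weakly_idempotent_complete E ->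
  weakly_omega_AdMon_elementary D -> weakly_omega_AdMon_elementary E ->
  homologically_right_complete T -> admissible_truncation T ->
  preserves_countable_coproducts F ->
  homological_left_deformation_of (Ch_functor F) B ->
  left_deformable (Ch_functor F).
Proof.
move=> wicD wicE elD elE Tc Ta Fc [[Bext [Qp [rho [rho_qi _ conc]]]] FB].
have /dep_choice [Q /dep_choice [c hc]] :=
  res_colimit_exists elD Bext rho (trunc_plus_map T).
(* Choice is made over the type of all morphisms with their endpoints, so that [Q] gets a single
   action on arrows; uniqueness of maps out of the colimit makes it functorial. *)
have /dep_choice [Qmap QmapE] : forall XYf : {XY : Ch D * Ch D & hom XY.1 XY.2},
    exists w : hom (Q (projT1 XYf).1) (Q (projT1 XYf).2), forall n,
      w ∘ c (projT1 XYf).1 n = c (projT1 XYf).2 n ∘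
        res_fmap Bext rho (trunc_plus_map T) n (projT2 XYf).
  by move=> [[X Y] f]; exact: Q_fmap_exists.
pose Qm X Y (f : hom X Y) := Qmap (existT (fun XY : Ch D * Ch D => hom XY.1 XY.2) (X,
  Y) f).
have QmE X Y (f : hom X Y) : forall n, Qm X Y f ∘ c X n = c Y n ∘
    res_fmap Bext rho (trunc_plus_map T) n f.
  exact: (QmapE (existT (fun XY : Ch D * Ch D => hom XY.1 XY.2) (X, Y) f)).
have /dep_choice [eta heta] : forall X, exists eta : hom (Q X) X,
    quasi_iso eta /\ forall n, eta ∘ c X n = alpha T Bext rho n X.
  by move=> X; have [e] := Q_eta_exists wicD elD Tc Ta rho_qi hc X; exists e.
have eta_qi X := (heta X).1; have etaE X := (heta X).2.
pose QF : functor (Ch D) (Ch D) :=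
  @Functor (Ch D) (Ch D) Q Qm (Qmap_id hc QmE) (Qmap_comp hc QmE).
pose etaF : nat_trans QF (id_functor (Ch D)) :=
  @NatTrans _ _ QF (id_functor (Ch D)) eta (eta_nat hc QmE etaE).
pose CF := Ch_functor F.
have FQ (X Y : Ch D) (f : hom X Y) : quasi_iso f -> quasi_iso (fmap CF (Qm X Y f)).
  exact: (FQ_qi wicD wicE elD elE Fc rho_qi FB hc QmE).
have Fiso (X Y : Ch D) (f : hom X Y) : is_iso f -> quasi_iso (fmap CF f).
  by move=> iso_f; apply: qi_iso => //; exact: fmap_is_iso.
(* An isomorphism from [Q Z] to [X] transports the result for [Q Z] to [X], by naturality of
   [eta]. *)
have Feta X : essential_image QF X -> quasi_iso (fmap CF (eta X)).
  move=> [Z [i iso_i]].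
  apply: (Ch_qi_right wicE elE (f := fmap CF (Qm _ _ i))).
    by apply: FQ; exact: qi_iso.
  rewrite -fmap_comp (eta_nat hc QmE etaE) fmap_comp.
  apply: Ch_qi_comp => //; last exact: Fiso.
  exact: (F_eta_Q_qi wicD wicE elD elE Fc rho_qi conc FB hc eta_qi etaE).
exists QF, etaF; split; first exact: eta_qi.
move=> X Y f /Feta hX /Feta hY qf.
(* In the naturality square of [eta] at [f], the functor [F] sends [Q f] and both components of
   [eta] to quasi-isomorphisms, so it does the same to [f]. *)
apply: (Ch_qi_right wicE elE (f := fmap CF (eta X))) => //.
rewrite -fmap_comp -(eta_nat hc QmE etaE) fmap_comp.
by apply: Ch_qi_comp => //; exact: FQ.
Qed.
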